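(* Let $R$ be a set and let $P=x_1\ldots x_{n+1}$ be an $R$-deco polygon of weight $n$. Then $$q_n\big(\Lambda_{\phi_2}(P)+(-1)^n\Lambda_{\phi_2}(\tau P)\big)=q_n\Big(\sum_{i=2}^{n}(-1)^{n-i}\,\Lambda_{\phi_2}\big(P^{\mathrm{rt}}_{{}_i\alpha}\big)\,\sqcup\!\sqcup\,\Lambda_{\phi_2}\big(\tau(P^{\mathrm{co}}_{{}_i\alpha})\big)\Big),$$ where ${}_i\alpha$ is the arrow of $P$ from vertex $i$ to the root side, so that $P^{\mathrm{rt}}_{{}_i\alpha}=x_1\ldots x_{i-1}x_{n+1}$ and $P^{\mathrm{co}}_{{}_i\alpha}=x_i\ldots x_nx_{n+1}$.
   Context: **Polygons.** Let $R$ be a set. An $R$-deco polygon of weight $n\ge1$ is a convex oriented $(n+1)$-gon with sides labelled by elements of $R$, a distinguished root side, and a marked first vertex which is an endpoint of the root side; the orientation starts at the first vertex and ends with the root side. It is written $x_1\ldots x_{n+1}$, listing the labels along the orientation (drawn counterclockwise), so $x_{n+1}$ labels the root side. Side $j$ goes from vertex $j$ to vertex $j+1$ (indices mod $n+1$; vertex $1$ is the first vertex). $V_n(R)$ is the $\mathbb{Q}$-vector space with basis the polygons of weight $n$; $V_0(R)=\mathbb{Q}$ is spanned by the trivial polygon $1$; $V_\bullet(R)=\bigoplus_{n\ge0}V_n(R)$. The map $\tau$ reverses orientation: $\tau(x_1\ldots x_nx_{n+1})=x_n\ldots x_1x_{n+1}$. **Arrows and dissections.** An arrow ${}_i\alpha_j$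 of $P$ goes from vertex $i$ to side $j$, where $j\not\equiv i,i-1 \pmod{n+1}$ (non-trivial arrows). It is forwards if $i<j$ and backwards if $j<i$. A dissection of $P$ is a set $d$ of pairwise non-intersecting arrows, i.e. arrows that can be drawn in the polygon with no common points except possibly a common starting vertex (arrows ending on the same side end at different points). $D(P)$ is the set of dissections of $P$, including the empty one; $|d|$ is the number of arrows. Contracting an arrow ${}_i\alpha_j$ of $P=x_1\ldots x_{n+1}$ splits $P$ into the root polygon $P^{\mathrm{rt}}$ and the cut-off polygon $P^{\mathrm{co}}$: if $i<j$, $P^{\mathrm{rt}}=x_1\ldots x_{i-1}x_j\ldots x_{n+1}$ and $P^{\mathrm{co}}=x_ix_{i+1}\ldots x_j$; if $j<i$, $P^{\mathrm{rt}}=x_1\ldots x_jx_i\ldots x_{n+1}$ and $P^{\mathrm{co}}=x_{j+1}\ldots x_{i-1}x_j$. Contracting all arrows of $d$ (in any order) gives $|d|+1$ subpolygons, one for each region cut out by $d$. **Words and linearization.** $\bar T(V_\bullet(R))=\bigoplus_{k\ge0}V_{\ge1}(R)^{\otimes k}$ is spanned by words $[Q_1|\ldots|Q_k]$ in polygons; $\sqcup\!\sqcup$ is the shuffle product. For a finite tree (or forest) $T$ with oriented edges and vertices labelled by polygons, $\Lambda(T)$ is the sum, over all total orderings of the vertices of $T$ in which the initial vertex of each edge precedes its final vertex, of the words obtained by writing the labels in that order; $\Lambda$ is extended linearly. **The trees $T_{\phi_2,d}(P)$.** For $d\in D(P)$, $T_{\phi_2,d}(P)$ is a sign times the following rooted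 tree. Its vertices are the regions of $d$, its edges are the arrows of $d$ (joining the two regions on the two sides of the arrow), the root is the region containing the part of the root side near the first vertex, and edges are oriented away from the root. The root vertex is labelled by the subpolygon of its region. The final vertex of the edge $\alpha$ is labelled by the subpolygon $Q$ of its region if $\alpha$ is forwards, and by $\tau(Q)$ if $\alpha$ is backwards. The sign is $\mathrm{sgn}_{\phi_2}(d)=\prod_{\alpha\in d\text{ backwards}}(-1)^{w(\alpha)}$ where $w(\alpha)$ is the weight of the label of the final vertex of $\alpha$ in this tree. Set $\Lambda_{\phi_2}(P)=\sum_{d\in D(P)}\Lambda(T_{\phi_2,d}(P))$. **The quotient.** $I_k\subset V_k(R)$ is the linear span of $\{Q+(-1)^k\tau Q: Q\text{ a polygon of weight }k\}$, and $q_n:\bar T(V_\bullet(R))\to\bar T(V_\bullet(R))/(\sum_{k=1}^nI_k)$ is the quotient map by the two-sided ideal for concatenation generated by $\sum_{k=1}^n I_k$, i.e. the span of words having at least one letter in some $I_k$, $1\le k\le n$. *)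

(* Defs.v *)
From HB Require Import structures.
From mathcomp Require Import all_boot all_order all_algebra.
From mathcomp Require Import zify.
From mathcomp Require Import generic_quotient ring_quotient.
From mathcomp Require Import finmap monalg.
From mathcomp Require Import boolp.

Set Implicit Arguments.
Unset Strict Implicit.
Unset Printing Implicit Defensive.

Import GRing.Theory.
Local Open Scope ring_scope.

(* A decorated polygon of weight n >= 1 is the list x_1 ... x_(n+1) of the
   labels of its sides along the orientation, the last one being that of the
   root side. *)
Record polygon (R : Type) := Polygon {
  sides :> seq R;
  sides_gt1 : (1 < size sides)%N
}.
HB.instance Definition _ (R : Type) := [isSub for @sides R].
HB.instance Definition _ (R : eqType) := [Equality of polygon R by <:].
HB.instance Definition _ (R : choiceType) := [Choice of polygon R by <:].

Definition weight (R : Type) (P : polygon R) : nat := (size P).-1.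

Lemma tau_subproof (R : Type) (P : polygon R) : (1 < size (rot 1 (rev P)))%N.
Proof. by rewrite size_rot size_rev sides_gt1. Qed.

(* rev gives x_(n+1) x_n ... x_1, so rot 1 puts the root label back last. *)
Definition tau (R : Type) (P : polygon R) : polygon R :=
  Polygon (tau_subproof P).

(* In what follows vertices and sides are numbered from 0: side j goes from
   vertex j to vertex j+1 mod N, vertex 0 is the first vertex and side N-1 the
   root side. The pair (i, j) is the arrow from vertex i to side j. *)
Definition arrow (N : nat) := ('I_N * 'I_N)%type.

Section Dissections.
Variable N : nat.
Implicit Types (a b : arrow N) (d : {set arrow N}) (r : option (arrow N)).

Definition nontrivial a : bool :=
  (a.2 != a.1 %[mod N])%N && (a.2.+1 != a.1 %[mod N])%N.

Definition forwards a : bool := (a.1 < a.2)%N.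
Definition backwards a : bool := (a.2 < a.1)%N.

(* Cut the boundary on the root side, between the first vertex and the end
   points of all arrows ending there. Along the resulting segment, vertex i has
   position 2i and the points of side j at which arrows may end have position
   2j+1; an arrow spans the interval [lo, hi]. Of the two sides of an arrow, the
   one away from the root region is this interval. *)
Definition spos (k : 'I_N) : nat := k.*2.+1.
Definition lo a : nat := minn a.1.*2 (spos a.2).
Definition hi a : nat := maxn a.1.*2 (spos a.2).

(* The inequalities are strict: arrows may share their starting vertex, and
   arrows ending on the same side can be given distinct end points there in an
   order that makes them disjoint. *)
Definition crossing a b : bool :=
  [&& lo a < lo b, lo b < hi a & hi a < hi b]%N
  || [&& lo b < lo a, lo a < hi b & hi b < hi a]%N.

Definition dissection d : bool :=
  [forall a in d, nontrivial a]
  && [forall a in d, forall b in d, ~~ crossing a b].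

(* The regions of d are indexed by option (arrow N): None is the root region
   and Some a, for a in d, the region adjacent to a on the side of a away from
   the root region. *)
Definition regions d : {set option (arrow N)} := None |: (Some @: d).

(* b lies strictly beyond a, resp. beyond the entrance of the region r *)
Definition beyond a b : bool := [&& b != a, lo a <= lo b & hi b <= hi a]%N.
Definition beyondr r b : bool := if r is Some a then beyond a b else true.

(* The arrow a of d joins the region Some a to the region on its other side,
   entered by the innermost arrow of d enclosing a (or the root region). *)
Definition region_edge d r r' : bool :=
  if r' is Some a then
    beyondr r a && [forall c in d, ~~ (beyondr r c && beyond c a)]
  else false.

(* Side k contributes to the region r iff a part of it lies beyond the entrance
   of r and it is not entirely cut off by an arrow of d beyond this entrance.
   A side on which arrows end contributes to several regions, but at most once
   to each of them. *)
Definition on_region d r (k : 'I_N) : bool :=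
  (if r is Some a then (lo a <= spos k <= hi a)%N else true)
  && [forall b in d, beyondr r b ==> ~~ (lo b < spos k < hi b)%N].

(* The sides of the subpolygon of a region along the inherited orientation,
   starting from its first vertex. The root side of the subpolygon beyond an
   arrow is the end side of the arrow; it is met first along the interval
   [lo, hi] when the arrow is backwards. *)
Definition region_sides d r : seq 'I_N :=
  let s := [seq k <- enum 'I_N | on_region d r k] in
  if r is Some a then (if backwards a then rot 1 s else s) else s.

Lemma dissectionP d : reflect
  ((forall a, a \in d -> nontrivial a)
   /\ (forall a b, a \in d -> b \in d -> ~~ crossing a b))
  (dissection d).
Proof.
apply: (iffP andP) => -[dN dX]; split.
- by move=> a ad; apply: (implyP (forallP dN a)).
- by move=> a b ad bd;
    apply: (implyP (forallP (implyP (forallP dX a) ad) b)).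
- by apply/forallP => a; apply/implyP => /dN.
- by apply/forallP => a; apply/implyP => ad; apply/forallP => b; apply/implyP;
    exact: dX.
Qed.

Lemma nontrivial_neq a : nontrivial a ->
  [/\ a.2 != a.1 :> nat, a.2.+1 != a.1 :> nat
    & ~~ ((a.1 == 0 :> nat) && (a.2.+1 == N))].
Proof.
case: a => i j; rewrite /nontrivial /=; have iN := ltn_ord i.
have jN := ltn_ord j; rewrite !(modn_small iN) (modn_small jN) => /andP[-> jSi].
split=> //; last first.
  apply/negP => /andP[/eqP i0 /eqP jE].
  by move: jSi; rewrite jE modnn i0.
apply/negP => /eqP jE; move: jSi; rewrite jE modn_small ?eqxx //.
Qed.

Lemma region_sides_gt1 d r : (1 < N)%N -> dissection d -> r \in regions d ->
  (1 < size (region_sides d r))%N.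
Proof.
move=> N1 /dissectionP[dN dX] rd.
have -> : size (region_sides d r) = #|on_region d r|.
  rewrite /region_sides enumT cardE.
  by case: r {rd} => [a|] //; case: ifP; rewrite ?size_rot.
suff [k1 [k2 [k12 k1r k2r]]] : exists k1 k2 : 'I_N,
    [/\ k1 != k2, on_region d r k1 & on_region d r k2].
  apply: (@leq_trans #|[set k1; k2]|); first by rewrite cards2 k12.
  by apply: subset_leq_card; apply/subsetP => k; rewrite !inE => /orP[] /eqP->.
have fw (i j : 'I_N) : (i < j)%N ->
    (forall b, b \in d -> beyondr r b ->
       [/\ i.*2 <= lo b, hi b <= j.*2.+1
         & (b.1 = i :> nat) -> b.2 != j :> nat]%N) ->
    (forall k : 'I_N, (i.*2 <= k.*2.+1 <= j.*2.+1)%N ->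
       (if r is Some a then (lo a <= spos k <= hi a)%N else true)) ->
    exists k1 k2 : 'I_N,
      [/\ k1 != k2, on_region d r k1 & on_region d r k2].
  move=> ij bP rP; exists j.
  pose Q (k : 'I_N) := (k == i)
    || ((i < k)%N && ((i, k) \in d) && beyondr r (i, k)).
  have Qi : Q i by rewrite /Q eqxx.
  have [k [Qk kmax]] : exists k : 'I_N,
      Q k /\ forall k' : 'I_N, Q k' -> (k' <= k)%N.
    by case: (arg_maxnP (fun k : 'I_N => k : nat) Qi) => k Qk kmax; exists k.
  have kj : (i <= k < j)%N.
    case/orP: Qk => [/eqP->|]; first by rewrite leqnn.
    case/andP=> /andP[ik ikd] ikr; have [_] := bP _ ikd ikr.
    rewrite /hi /spos /= => h /(_ erefl) /eqP h2; lia.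
  exists k; split.
  - by apply/eqP => jk; move: kj; rewrite jk; lia.
  - rewrite /on_region rP /=; last by lia.
    apply/forallP => -[u v]; apply/implyP => bd; apply/implyP => br.
    by have [h1 h2 _] := bP (u, v) bd br; rewrite /spos; lia.
  - rewrite /on_region rP /=; last by lia.
    apply/forallP => -[u v]; apply/implyP => bd; apply/implyP => br.
    have [h1 h2 _] := bP (u, v) bd br; apply/negP => /andP[b1 b2].
    have [uE|uN] := eqVneq u i.
      have Qv : Q v.
        have ltv : (i < v)%N.
          by move: h1 h2 b1 b2; rewrite uE /lo /hi /spos /=; lia.
        by rewrite /Q -uE bd br uE ltv orbT.
      have := kmax _ Qv; move: h1 h2 b1 b2; rewrite uE /lo /hi /spos /=; lia.
    have {}uN : u != i :> nat by [].
    have ib : (i.*2 < lo (u, v))%N.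
      by move: h1 b1 b2 => /=; rewrite /lo /hi /spos /=; lia.
    case/orP: Qk => [/eqP kE|/andP[/andP[ik ikd] _]].
      by move: b1 b2 ib; rewrite kE /spos /=; lia.
    have := dX _ _ ikd bd; rewrite /crossing negb_or => /andP[/negP[]].
    by move: b1 b2 ib; rewrite /lo /hi /spos /=; lia.
have bw (i j : 'I_N) : (j.+1 < i)%N ->
    (forall b, b \in d -> beyondr r b ->
       [/\ j.*2.+1 <= lo b, hi b <= i.*2
         & (b.1 = i :> nat) -> b.2 != j :> nat]%N) ->
    (forall k : 'I_N, (j.*2.+1 <= k.*2.+1 <= i.*2)%N ->
       (if r is Some a then (lo a <= spos k <= hi a)%N else true)) ->
    exists k1 k2 : 'I_N,
      [/\ k1 != k2, on_region d r k1 & on_region d r k2].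
  move=> ij bP rP; exists j.
  have i1N : (i.-1 < N)%N by have := ltn_ord i; lia.
  pose i1 := Ordinal i1N.
  pose Q (k : 'I_N) := (k == i1)
    || ((k < i)%N && ((i, k) \in d) && beyondr r (i, k)).
  have Qi : Q i1 by rewrite /Q eqxx.
  have [k [Qk kmin]] : exists k : 'I_N,
      Q k /\ forall k' : 'I_N, Q k' -> (k <= k')%N.
    by case: (arg_minnP (fun k : 'I_N => k : nat) Qi) => k Qk kmin; exists k.
  have kj : (j < k < i)%N.
    case/orP: Qk => [/eqP->|]; first by rewrite /=; lia.
    case/andP=> /andP[ik ikd] ikr; have [] := bP _ ikd ikr.
    rewrite /lo /spos /= => h _ /(_ erefl) /eqP h2; lia.
  exists k; split.
  - by apply/eqP => jk; move: kj; rewrite jk; lia.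
  - rewrite /on_region rP /=; last by lia.
    apply/forallP => -[u v]; apply/implyP => bd; apply/implyP => br.
    by have [h1 h2 _] := bP (u, v) bd br; rewrite /spos; lia.
  - rewrite /on_region rP /=; last by lia.
    apply/forallP => -[u v]; apply/implyP => bd; apply/implyP => br.
    have [h1 h2 _] := bP (u, v) bd br; apply/negP => /andP[b1 b2].
    have [uE|uN] := eqVneq u i.
      have Qv : Q v.
        have ltv : (v < i)%N.
          by move: h1 h2 b1 b2; rewrite uE /lo /hi /spos /=; lia.
        by rewrite /Q -uE bd br uE ltv orbT.
      have := kmin _ Qv; move: h1 h2 b1 b2; rewrite uE /lo /hi /spos /=; lia.
    have {}uN : u != i :> nat by [].
    have ib : (hi (u, v) < i.*2)%N.
      by move: h2 b1 b2 => /=; rewrite /lo /hi /spos /=; lia.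
    case/orP: Qk => [/eqP kE|/andP[/andP[ik ikd] _]].
      by move: b1 b2 ib; rewrite kE /spos /=; lia.
    have := dX _ _ bd ikd; rewrite /crossing negb_or => /andP[/negP[]].
    by move: b1 b2 ib; rewrite /lo /hi /spos /=; lia.
case: r rd fw bw => [a|] rd fw bw.
  have ad : a \in d.
    by move: rd; rewrite !inE /= => /imsetP[a' a'd [->]].
  have [a1 a2 _] := nontrivial_neq (dN a ad).
  have aneq b : beyond a b -> b.1 = a.1 :> nat -> b.2 != a.2 :> nat.
    move=> /and3P[ba _ _] b1; apply/negP => /eqP b2; case/eqP: ba.
    case: a b b1 b2 {rd fw bw ad a1 a2} => [u v] [u' v'] /= b1 b2.
    by congr pair; apply: val_inj.
  have [lt12|le21] := ltnP a.1 a.2.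
    apply: (fw _ _ lt12) => [b bd br|k]; last by rewrite /lo /hi /spos /=; lia.
    split; last exact: aneq.
      by move: br => /and3P[_]; rewrite /lo /hi /spos /=; lia.
    by move: br => /and3P[_]; rewrite /lo /hi /spos /=; lia.
  have lt21 : (a.2.+1 < a.1)%N by lia.
  apply: (bw _ _ lt21) => [b bd br|k]; last by rewrite /lo /hi /spos /=; lia.
  split; last exact: aneq.
    by move: br => /and3P[_]; rewrite /lo /hi /spos /=; lia.
  by move: br => /and3P[_]; rewrite /lo /hi /spos /=; lia.
have i0 : (0 < N)%N by lia.
have j0 : (N.-1 < N)%N by lia.
apply: (fw (Ordinal i0) (Ordinal j0)) => [|b bd _|//]; first by rewrite /=; lia.
have [b1 b2 b3] := nontrivial_neq (dN b bd).
have := ltn_ord b.1; have := ltn_ord b.2; rewrite /lo /hi /spos /=.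
by split; lia.
Qed.

End Dissections.

(* mkpoly P s is the polygon with list of sides s; P is a dummy value, for
   ill-formed s only (see subpolyE, prtE and pcoE). *)
Definition mkpoly (R : Type) (P : polygon R) (s : seq R) : polygon R :=
  insubd P s.

Definition subpoly (R : Type) (P : polygon R) (d : {set arrow (size P)})
    (r : option (arrow (size P))) : polygon R :=
  mkpoly P [seq tnth (in_tuple P) k | k <- region_sides d r].

Lemma subpolyE (R : Type) (P : polygon R) (d : {set arrow (size P)}) r :
  dissection d -> r \in regions d ->
  subpoly d r = [seq tnth (in_tuple P) k | k <- region_sides d r] :> seq R.
Proof.
move=> dD rd; rewrite /subpoly /mkpoly -[sides _]/(val _) insubdK //.
by rewrite -topredE /= size_map region_sides_gt1 ?sides_gt1.
Qed.

(* The root and cut-off polygons of the arrow from vertex i to side j. *)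
Definition prt (R : Type) (P : polygon R) (i j : nat) : polygon R :=
  mkpoly P (if (i < j)%N then take i P ++ drop j P
            else take j.+1 P ++ drop i P).
Definition pco (R : Type) (P : polygon R) (i j : nat) : polygon R :=
  mkpoly P (if (i < j)%N then drop i (take j.+1 P)
            else rot 1 (drop j (take i P))).

Lemma prtE (R : Type) (P : polygon R) (a : arrow (size P)) :
  nontrivial a ->
  prt P a.1 a.2 = (if forwards a then take a.1 P ++ drop a.2 P
                   else take a.2.+1 P ++ drop a.1 P) :> seq R.
Proof.
move=> /nontrivial_neq[]; have := ltn_ord a.1; have := ltn_ord a.2.
case: a => i j /= jN iN ij ji /negP Nij.
rewrite /prt /mkpoly /forwards -[sides (insubd _ _)]/(val _) /=.
rewrite insubdK // -topredE /=.
by case: ifP => ?; rewrite size_cat size_drop size_take_min; lia.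
Qed.

Lemma pcoE (R : Type) (P : polygon R) (a : arrow (size P)) :
  nontrivial a ->
  pco P a.1 a.2 = (if forwards a then drop a.1 (take a.2.+1 P)
                   else rot 1 (drop a.2 (take a.1 P))) :> seq R.
Proof.
move=> /nontrivial_neq[]; have := ltn_ord a.1; have := ltn_ord a.2.
case: a => i j /= jN iN ij ji /negP Nij.
rewrite /pco /mkpoly /forwards -[sides (insubd _ _)]/(val _) /=.
rewrite insubdK // -topredE /=.
by case: ifP => ?; rewrite ?size_rot size_drop size_take_min; lia.
Qed.

(* V_(>=1)(R), and the tensor algebra on it realised as the free associative
   algebra on polygons. *)
Notation Vpoly R := {malg rat[polygon R]}.
Notation Tpoly R := {malg rat[{fmonom (polygon R)}]}.

Definition word (R : choiceType) (w : seq (polygon R)) : Tpoly R :=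
  << FMonom w >>.

Lemma word_cat (R : choiceType) (u v : seq (polygon R)) :
  word (u ++ v) = word u * word v.
Proof.
rewrite /word malgM_def fgmulUU mulr1.
by congr << _ >>; rewrite /mmul /= /fmmul fmE.
Qed.

Fixpoint shuffles (A : Type) (u v : seq A) {struct u} : seq (seq A) :=
  match u with
  | [::] => [:: v]
  | x :: u' =>
    (fix aux (v : seq A) : seq (seq A) :=
       match v with
       | [::] => [:: u]
       | y :: v' => map (cons x) (shuffles u' v) ++ map (cons y) (aux v')
       end) v
  end.

Definition shuffle (R : choiceType) (x y : Tpoly R) : Tpoly R :=
  \sum_(u <- msupp x) \sum_(v <- msupp y)
    (x@_u * y@_v) *: \sum_(w <- shuffles u v) word w.

(* Finite oriented forests with vertices labelled by polygons. *)
Record forest (R : Type) := Forest {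
  fnode : finType;
  fnodes : {set fnode};
  fedge : rel fnode;
  flabel : fnode -> polygon R
}.

Definition linear_ext (V : finType) (A : {set V}) (E : rel V) (s : seq V) :=
  [forall u in A, forall v in A, E u v ==> (index u s < index v s)%N].

Definition Lambda (R : choiceType) (F : forest R) : Tpoly R :=
  \sum_(s <- permutations (enum (fnodes F))
       | linear_ext (fnodes F) (@fedge _ F) s)
    word [seq flabel v | v <- s].

Definition label_phi2 (R : Type) (P : polygon R) (d : {set arrow (size P)})
    (r : option (arrow (size P))) : polygon R :=
  if r is Some a then
    if backwards a then tau (subpoly d r) else subpoly d r
  else subpoly d r.

Definition tree_phi2 (R : Type) (P : polygon R) (d : {set arrow (size P)}) :
    forest R :=
  Forest (regions d) (region_edge d) (label_phi2 d).

Definition sgn_phi2 (R : Type) (P : polygon R) (d : {set arrow (size P)}) :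
    rat :=
  \prod_(a in d | backwards a) (-1) ^+ weight (label_phi2 d (Some a)).

Definition Lambda_phi2 (R : choiceType) (P : polygon R) : Tpoly R :=
  \sum_(d : {set arrow (size P)} | dissection d)
    sgn_phi2 d *: Lambda (tree_phi2 d).

Definition span (V : lmodType rat) (S : V -> Prop) (x : V) : Prop :=
  exists2 s : seq (rat * V),
    (forall p, p \in s -> S p.2) & x = \sum_(p <- s) p.1 *: p.2.

Definition I_ (R : choiceType) (k : nat) : Vpoly R -> Prop :=
  span (fun v => exists2 Q : polygon R,
    weight Q = k & v = << Q >> + (-1) ^+ k *: << tau Q >>).

(* The inclusion of V_(>=1)(R) as the one-letter words. *)
Definition letter (R : choiceType) (v : Vpoly R) : Tpoly R :=
  \sum_(Q <- msupp v) v@_Q *: word [:: Q].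

Definition in_ideal (R : choiceType) (n : nat) : Tpoly R -> Prop :=
  span (fun z => exists (k : nat) (v : Vpoly R) (x y : Tpoly R),
    [/\ (1 <= k <= n)%N, I_ k v & z = x * letter v * y]).

Section Span.
Variables (V : lmodType rat) (S : V -> Prop).

Lemma span0 : span S 0.
Proof. by exists [::]; rewrite ?big_nil. Qed.

Lemma spanB x y : span S x -> span S y -> span S (x - y).
Proof.
move=> [s Ss ->] [t St ->]; exists (s ++ [seq (- p.1, p.2) | p <- t]).
  move=> p; rewrite mem_cat => /orP[/Ss //|/mapP[p' /St Sp' -> //]].
rewrite big_cat big_map /= -sumrN; congr (_ + _).
by apply: eq_bigr => p _; rewrite scaleNr.
Qed.

End Span.

Section Quotient.
Variables (R : choiceType) (n : nat).

Definition ideal : {pred Tpoly R} := fun x => `[< in_ideal n x >].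

Lemma ideal_zmod_closed : zmod_closed ideal.
Proof.
split=> [|x y /asboolP xI /asboolP yI]; apply/asboolP; first exact: span0.
exact: spanB.
Qed.

HB.instance Definition _ :=
  GRing.isZmodClosed.Build (Tpoly R) ideal ideal_zmod_closed.

Definition Tquot : Type := Quotient.quot ideal.

Definition q_ (x : Tpoly R) : Tquot := (\pi_(Quotient.quot ideal) x)%qT.

Lemma qP (x y : Tpoly R) : q_ x = q_ y <-> in_ideal n (x - y).
Proof.
rewrite /q_; split=> [/eqP|xyI].
  by rewrite -Quotient.idealrBE => /asboolP.
by apply/eqP; rewrite -Quotient.idealrBE; apply/asboolP.
Qed.

End Quotient.

(* Main.v *)
From HB Require Import structures.
Require Import Defs.
From mathcomp Require Import all_boot all_order all_algebra.
From mathcomp Require Import zify ring.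
From mathcomp Require Import finmap monalg.
Import GRing.Theory.
Local Open Scope ring_scope.

Set Implicit Arguments.
Unset Strict Implicit.
Unset Printing Implicit Defensive.

(** Modulo the ideal, the letter [tau Q] equals [- (-1)^w Q], where [w] is the
    weight of [Q] ([cong_tau]); up to signs, reflecting letters is therefore
    harmless, and both sides of the congruence become sums over dissections of
    [P], with the same letters on both sides.

    In a dissection [d] with [k] arrows ending on the root side, the regions
    meeting the root side form a path R_0, ..., R_k of the tree, its spine; all
    other edges, the ribs, hang from the spine. A dissection of [tau P] is the
    mirror image of a dissection [d] of [P]. Its tree has the same ribs, but the
    other end of the spine as its root; the labels off the spine are unchanged,
    because the reflection exchanges forwards and backwards arrows, and those on
    the spine are reflected ([Lambda_sides_mirror]). Since the weights of the
    regions add up to [n] ([sum_wt]), the signs combine ([sgn_turn]), and the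
    left-hand side is congruent to the sum over [d] of [sgn d] times
      Lambda (R_0 -> ... -> R_k) - (-1)^k Lambda (R_0 <- ... <- R_k),
    where only the spine is displayed.

    On the right-hand side, a pair formed by a dissection of the root polygon
    and one of the cut-off polygon of the arrow from vertex i to the root side
    is a dissection of [P] containing this arrow ([eq_glue_sum]). The shuffle
    product is the [Lambda] of the disjoint union of the two trees
    ([Lambda_disjoint]), that is, of the forest obtained from the tree of [d] by
    removing an edge of the spine and turning round its second half. The
    right-hand side thus becomes the sum over [d] of [sgn d] times
      sum_(0 < s <= k) (-1)^(k - s)
        Lambda (R_0 -> ... -> R_(s-1)   R_s <- ... <- R_k).

    For each [d] the two expressions agree ([Lambda_telescope]): an ordering of
    the regions that rises along the spine up to its maximum and falls
    afterwards satisfies the conditions for exactly two consecutive cut points,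
    just before and just after the maximum, and these cancel in the alternating
    sum. *)


(** * Linearity of letters and shuffle products *)
Section LinearExtension.
Variables (K : choiceType) (V : lmodType rat) (f : K -> V).

(** Letters and shuffle products are defined by sums over supports, which are
    not visibly additive; both are instances of this linear extension of a
    function given on the basis. *)
Definition linearize (x : {malg rat[K]}) : V := \sum_(k <- msupp x) x@_k *: f k.

Lemma linearizeEw (D : {fset K}) (x : {malg rat[K]}) :
  (msupp x `<=` D)%fset -> linearize x = \sum_(k <- D) x@_k *: f k.
Proof.
move=> xD; rewrite /linearize (big_fset_incl _ xD) // => k _.
by move/mcoeff_outdom => ->; rewrite scale0r.
Qed.

Lemma linearizeP a x y : linearize (a *: x + y) = a *: linearize x + linearize y.
Proof.
pose D := (msupp x `|` msupp y)%fset.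
have xD : (msupp x `<=` D)%fset by apply: fsubsetUl.
have yD : (msupp y `<=` D)%fset by apply: fsubsetUr.
have zD : (msupp (a *: x + y) `<=` D)%fset.
  apply: fsubset_trans (msuppD_le _ _) _.
  by rewrite fsubUset yD andbT (fsubset_trans (msuppZ_le _ _) xD).
rewrite (linearizeEw xD) (linearizeEw yD) (linearizeEw zD).
rewrite scaler_sumr -big_split /=.
by apply: eq_bigr => k _; rewrite mcoeffD mcoeffZ scalerDl scalerA.
Qed.

HB.instance Definition _ :=
  GRing.isLinear.Build rat {malg rat[K]} V *:%R linearize linearizeP.

Lemma linearizeU k : linearize << k >> = f k.
Proof. by rewrite (linearizeEw msuppU_le) big_seq_fset1 mcoeffUU scale1r. Qed.

End LinearExtension.

Section LinearExtensionFun.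
Variables (K : choiceType) (V : lmodType rat) (x : {malg rat[K]}).

Lemma eq_linearize (f g : K -> V) : f =1 g -> linearize f x = linearize g x.
Proof. by move=> fg; apply: eq_bigr => k _; rewrite fg. Qed.

Lemma linearize_sum (I : Type) (r : seq I) (P : pred I) (F : I -> K -> V) :
  linearize (fun k => \sum_(i <- r | P i) F i k) x
  = \sum_(i <- r | P i) linearize (F i) x.
Proof.
by rewrite /linearize exchange_big; apply: eq_bigr => k _; rewrite scaler_sumr.
Qed.

Lemma linearize_scale a (f : K -> V) :
  linearize (fun k => a *: f k) x = a *: linearize f x.
Proof.
rewrite /linearize scaler_sumr; apply: eq_bigr => k _.
by rewrite !scalerA mulrC.
Qed.

End LinearExtensionFun.

Section Tensors.
Variable R : choiceType.
Implicit Types (x y z : Tpoly R) (Q : polygon R) (u v w : seq (polygon R)).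

Lemma letter_linearize : @letter R = linearize (fun Q => word [:: Q]).
Proof. by []. Qed.

Lemma shuffle_linearize x y : shuffle x y =
  linearize (fun u : {fmonom polygon R} =>
    linearize (fun v : {fmonom polygon R} => \sum_(w <- shuffles u v) word w) y) x.
Proof.
rewrite /shuffle /linearize; apply: eq_bigr => u _; rewrite scaler_sumr.
by apply: eq_bigr => v _; rewrite scalerA.
Qed.

Lemma shuffle_suml (I : Type) (r : seq I) (P : pred I) (F : I -> Tpoly R) y :
  shuffle (\sum_(i <- r | P i) F i) y = \sum_(i <- r | P i) shuffle (F i) y.
Proof.
rewrite shuffle_linearize raddf_sum; apply: eq_bigr => i _.
by rewrite shuffle_linearize.
Qed.

Lemma shuffleZl a x y : shuffle (a *: x) y = a *: shuffle x y.
Proof. by rewrite !shuffle_linearize linearZ. Qed.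

Lemma shuffle_sumr (I : Type) (r : seq I) (P : pred I) (F : I -> Tpoly R) x :
  shuffle x (\sum_(i <- r | P i) F i) = \sum_(i <- r | P i) shuffle x (F i).
Proof.
rewrite shuffle_linearize.
under [RHS]eq_bigr do rewrite shuffle_linearize.
rewrite -linearize_sum; apply: eq_linearize => u; exact: raddf_sum.
Qed.

Lemma shuffleZr a x y : shuffle x (a *: y) = a *: shuffle x y.
Proof.
rewrite !shuffle_linearize -linearize_scale.
by apply: eq_linearize => u; exact: linearZ.
Qed.

Lemma shuffle_word u v :
  shuffle (word u) (word v) = \sum_(w <- shuffles u v) word w.
Proof. by rewrite shuffle_linearize /word !linearizeU. Qed.

End Tensors.

(** * Shuffles and orderings of forests *)
Section Seqs.
Variables (T : eqType).
Implicit Types (s t : seq T) (x y : T).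

Lemma index_map_in (T' : eqType) (f : T -> T') s x :
  {in s &, injective f} -> x \in s -> index (f x) (map f s) = index x s.
Proof.
elim: s => [|y s IHs] //= f_inj; rewrite inE => xs.
have yy : y \in y :: s by rewrite mem_head.
have -> : (f y == f x) = (y == x).
  by apply/eqP/eqP => [|->//]; apply: f_inj => //; rewrite inE.
case/predU1P: xs => [->|xs]; first by rewrite eqxx.
rewrite IHs //; apply: sub_in2 f_inj => u us; by rewrite inE us orbT.
Qed.

Lemma inj_in_map (T' : eqType) (f : T -> T') (A : {pred T}) s t :
  {in A &, injective f} -> {subset s <= A} -> {subset t <= A} ->
  map f s = map f t -> s = t.
Proof.
move=> f_inj; elim: s t => [|x s IHs] [|y t] //= sA tA [fxy fst].
congr cons; first exact: f_inj (sA _ (mem_head _ _)) (tA _ (mem_head _ _)) fxy.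
by apply: IHs => // v vs; [apply: sA|apply: tA]; rewrite inE vs orbT.
Qed.

Lemma index_filter_lt (a : pred T) s x y : a x -> a y ->
  (index x (filter a s) < index y (filter a s))%N = (index x s < index y s)%N.
Proof.
move=> ax ay; elim: s => [|z s IHs] //=; case: ifP => az /=.
  by case: (z == x); case: (z == y) => //=; rewrite ltnS IHs.
case: eqP => [zx|_]; first by rewrite zx ax in az.
by case: eqP => [zy|_]; [rewrite zy ay in az|rewrite ltnS IHs].
Qed.

Lemma shuffles_cons x s y t : shuffles (x :: s) (y :: t) =
  map (cons x) (shuffles s (y :: t)) ++ map (cons y) (shuffles (x :: s) t).
Proof. by []. Qed.

Lemma shuffles0r s : shuffles s [::] = [:: s].
Proof. by case: s. Qed.

Variable a : pred T.

(** If a predicate tells the entries of the two sequences apart, a shuffle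
    determines both of them, so that filtering inverts shuffling. *)
Lemma mem_shuffles s t u : all a s -> all (predC a) t ->
  (u \in shuffles s t) = (filter a u == s) && (filter (predC a) u == t).
Proof.
elim: u s t => [|z u IHu] s t sa ta.
  case: s t sa ta => [|x s] [|y t] //= _ _.
  by rewrite mem_cat; apply/negP => /orP[] /mapP[].
have cons_mem x r : (z :: u \in map (cons x) r) = (z == x) && (u \in r).
  apply/mapP/andP => [[v vr [-> ->]]|[/eqP-> ur]]; first by rewrite eqxx.
  by exists u.
case: s sa => [|x s] sa.
  rewrite /= inE; case: ifP => az /=.
    apply/negP => /eqP zt; move: ta; rewrite -zt /= az //.
  apply/eqP/andP => [zt|[/eqP fu /eqP <-]]; last first.
    congr cons; apply/esym/all_filterP/allP => v vu /=.
    apply/negP => av; have : v \in filter a u by rewrite mem_filter av.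
    by rewrite fu.
  move: ta; rewrite -zt /= => /andP[_ ta].
  split; last by apply/eqP; congr cons; apply/all_filterP.
  apply/eqP/nilP; rewrite /nilp size_filter.
  by rewrite -leqn0 leqNgt -has_count; apply/hasPn => v /(allP ta).
case: t ta => [|y t] ta.
  rewrite shuffles0r inE /=; case: ifP => az /=; last first.
    rewrite andbF; apply/negP => /eqP zt; move: sa; rewrite -zt /= az //.
  apply/eqP/andP => [zt|[/eqP <- /eqP fu]]; last first.
    congr cons; apply/esym/all_filterP/allP => v vu /=.
    apply/negPn/negP => av; have : v \in filter (predC a) u.
      by rewrite mem_filter /= av.
    by rewrite fu.
  move: sa; rewrite -zt /= => /andP[_ sa].
  split; first by apply/eqP; congr cons; apply/all_filterP.
  apply/eqP/nilP; rewrite /nilp size_filter.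
  rewrite -leqn0 leqNgt -has_count; apply/hasPn => v /(allP sa) /= -> //.
rewrite shuffles_cons mem_cat !cons_mem.
have /andP[ax {}sa'] := sa; have /andP[/= ay {}ta'] := ta.
rewrite (IHu _ _ sa' ta) (IHu _ _ sa ta') /=.
case: ifP => az /=; rewrite !eqseq_cons.
  case: (eqVneq z y) => [zy|_]; last by rewrite orbF andbA.
  by rewrite -zy az in ay.
case: (eqVneq z x) => [zx|_]; first by rewrite zx ax in az.
by case: (z == y); rewrite /= ?andbF.
Qed.

Lemma shuffles_uniq s t : all a s -> all (predC a) t -> uniq (shuffles s t).
Proof.
elim: s t => [|x s IHs] t //=; elim: t => [|y t IHt] //= /andP[ax sa].
case/andP=> ay ta; rewrite -[_ ++ _]/(_ ++ map (cons y) (shuffles (x :: s) t)).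
have cons_inj z : injective (cons z : seq T -> seq T) by move=> ? ? [].
rewrite cat_uniq !(map_inj_uniq (@cons_inj _)) IHs //= ?ay //.
rewrite [X in _ && X]IHt ?ax // andbT.
apply/hasPn => w /mapP[w1 _ ->]; apply/negP => /mapP[w2 _ [yx _]].
by rewrite yx ax in ay.
Qed.

End Seqs.

Lemma shuffles_map (T T' : Type) (f : T -> T') s t :
  shuffles (map f s) (map f t) = map (map f) (shuffles s t).
Proof.
elim: s t => [|x s IHs] t //=; elim: t => [|y t IHt] //=.
rewrite map_cat -!map_comp; congr (_ ++ _).
  rewrite -[_ :: _]/(map f (y :: t)) IHs -map_comp.
  exact: eq_map.
transitivity (map (cons (f y)) (shuffles (map f (x :: s)) (map f t))) => //.
by rewrite [shuffles _ _]IHt -map_comp; apply: eq_map.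
Qed.

Section LambdaForests.
Variables (R : choiceType) (V : finType).
Implicit Types (A : {set V}) (E : rel V) (l : V -> polygon R).

Lemma LambdaE A E l : Lambda (Forest A E l) =
  \sum_(s <- permutations (enum A) | linear_ext A E s) word (map l s).
Proof. by []. Qed.

Lemma mem_perms A s : s \in permutations (enum A) -> uniq s /\ s =i A.
Proof.
rewrite mem_permutations => sA.
by split=> [|v]; rewrite ?(perm_uniq sA) ?enum_uniq // (perm_mem sA) mem_enum.
Qed.

Lemma perms_mem A s : uniq s -> s =i A -> s \in permutations (enum A).
Proof.
move=> su sA; rewrite mem_permutations uniq_perm ?enum_uniq // => v.
by rewrite mem_enum sA.
Qed.

Lemma linear_extP A E s : reflect
  {in A &, forall u v, E u v -> (index u s < index v s)%N} (linear_ext A E s).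
Proof.
apply: (iffP forallP) => [H u v uA vA Euv|H u].
  by move/(_ u)/implyP/(_ uA)/forallP/(_ v)/implyP/(_ vA)/implyP: H; apply.
apply/implyP => uA; apply/forallP => v; apply/implyP => vA.
by apply/implyP; apply: H.
Qed.

Lemma eq_Lambda A E E' l l' : {in A &, E =2 E'} -> {in A, l =1 l'} ->
  Lambda (Forest A E l) = Lambda (Forest A E' l').
Proof.
move=> EE' ll'; rewrite !LambdaE big_seq_cond [RHS]big_seq_cond.
apply: eq_big => [s|s /andP[/mem_perms[_ sA] _]].
  by congr (_ && _); apply/linear_extP/linear_extP => H u v uA vA Euv;
    apply: H; rewrite // ?EE' // -EE'.
congr word; apply/eq_in_map => v; rewrite sA; exact: ll'.
Qed.

End LambdaForests.

Lemma Lambda_iso (R : choiceType) (V V' : finType) (A : {set V}) (E : rel V)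
    (l : V -> polygon R) (A' : {set V'}) (E' : rel V') (l' : V' -> polygon R)
    (f : V -> V') :
  {in A &, injective f} -> A' = f @: A ->
  {in A &, forall u v, E' (f u) (f v) = E u v} ->
  {in A, forall v, l' (f v) = l v} ->
  Lambda (Forest A' E' l') = Lambda (Forest A E l).
Proof.
move=> f_inj A'E EE' ll'; rewrite !LambdaE.
have -> : \sum_(s <- permutations (enum A') | linear_ext A' E' s)
    word (map l' s) = \sum_(s <- map (map f) (permutations (enum A))
      | linear_ext A' E' s) word (map l' s).
  apply: perm_big; rewrite perm_sym.
  have mfu : uniq (map (map f) (permutations (enum A))).
    rewrite map_inj_in_uniq ?permutations_uniq // => s t.
    move=> /mem_perms[_ sA] /mem_perms[_ tA].
    by apply: (inj_in_map f_inj) => v; rewrite ?sA ?tA.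
  apply: uniq_perm => //; first exact: permutations_uniq.
  apply: (uniq_min_size mfu _ _).2 => [_ /mapP[s /mem_perms[su sA] ->]|].
    apply: perms_mem => [|v].
      by rewrite map_inj_in_uniq // => u v; rewrite !sA; exact: f_inj.
    rewrite A'E; apply/mapP/imsetP => -[u uA ->]; exists u => //;
      by [rewrite -sA|rewrite sA].
  rewrite size_map !size_permutations ?enum_uniq // -!cardE.
  by rewrite A'E card_in_imset.
rewrite big_map big_seq_cond [RHS]big_seq_cond.
apply: eq_big => [s|s /andP[/mem_perms[_ sA] _]]; last first.
  congr word; rewrite -map_comp; apply/eq_in_map => v; rewrite sA; exact: ll'.
case sP: (s \in _) => //=; have [su sA] := mem_perms sP.
have sfinj : {in s &, injective f} by move=> u v; rewrite !sA; exact: f_inj.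
apply/linear_extP/linear_extP => H u v.
  move=> uA vA Euv; have := H (f u) (f v).
  rewrite !index_map_in ?sA // A'E !imset_f ?EE' //; exact.
rewrite A'E => /imsetP[u' uA ->] /imsetP[v' vA ->].
by rewrite EE' // !index_map_in ?sA //; exact: H.
Qed.

Lemma linear_ext_filter (V : finType) (A a : {set V}) (E : rel V) s :
  {in A &, forall u v, E u v -> (u \in a) = (v \in a)} ->
  linear_ext A E s = linear_ext (A :&: a) E (filter [in a] s)
    && linear_ext (A :\: a) E (filter (predC [in a]) s).
Proof.
move=> Ea; apply/linear_extP/andP => [H|[/linear_extP H1 /linear_extP H2]].
  split; apply/linear_extP => u v; rewrite !inE => /andP[u1 u2] /andP[v1 v2];
    by rewrite index_filter_lt //; apply: H.
move=> u v uA vA Euv; have uva := Ea u v uA vA Euv.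
have [ua|ua] := boolP (u \in a).
  have va : v \in a by rewrite -uva.
  rewrite -(@index_filter_lt _ [in a]) //.
  by apply: H1; rewrite ?inE ?uA ?ua ?vA ?va.
have va : v \notin a by rewrite -uva.
rewrite -(@index_filter_lt _ (predC [in a])) //.
by apply: H2; rewrite ?inE ?uA ?ua ?vA ?va.
Qed.

Lemma big_seq_pred1_if (V : nmodType) (T : eqType) (r : seq T) (P : pred T)
    (F : T -> V) x :
  uniq r -> x \in r ->
  \sum_(y <- r | P y && (x == y)) F y = if P x then F x else 0.
Proof.
move=> ur xr; rewrite big_mkcond (bigD1_seq x) //= eqxx andbT.
rewrite big1_seq ?addr0 // => y.
by case/andP=> yx _; rewrite eq_sym (negPf yx) andbF.
Qed.

(** An ordering of all nodes amounts to an ordering of each half and a shuffle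
    of the two; without edges between the halves, the conditions imposed by the
    edges bear on the two orderings separately. *)
Lemma Lambda_disjoint (R : choiceType) (V : finType) (A a : {set V})
    (E : rel V) (l : V -> polygon R) :
  {in A &, forall u v, E u v -> (u \in a) = (v \in a)} ->
  Lambda (Forest A E l)
  = shuffle (Lambda (Forest (A :&: a) E l)) (Lambda (Forest (A :\: a) E l)).
Proof.
move=> Ea; rewrite !LambdaE shuffle_suml.
under [RHS]eq_bigr do rewrite shuffle_sumr.
set P := permutations _; set P1 := permutations _; set P2 := permutations _.
have fP s : s \in P ->
    filter [in a] s \in P1 /\ filter (predC [in a]) s \in P2.
  move=> /mem_perms[su sA]; split; apply: perms_mem;
    rewrite ?filter_uniq // => v; by rewrite mem_filter sA !inE /= 1?andbC.
pose L1 := linear_ext (A :&: a) E; pose L2 := linear_ext (A :\: a) E.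
transitivity (\sum_(s1 <- P1 | L1 s1) \sum_(s2 <- P2 | L2 s2)
   \sum_(s <- P | (filter [in a] s == s1) && (filter (predC [in a]) s == s2))
     word (map l s)); last first.
  rewrite big_seq_cond [RHS]big_seq_cond; apply: eq_bigr => s1.
  move=> /andP[/mem_perms[us1 s1A] _].
  rewrite big_seq_cond [RHS]big_seq_cond; apply: eq_bigr => s2.
  move=> /andP[/mem_perms[us2 s2A] _].
  rewrite shuffle_word shuffles_map big_map -[LHS]big_filter. apply: perm_big.
  have as1 : all [in a] s1 by apply/allP => v; rewrite s1A inE => /andP[].
  have as2 : all (predC [in a]) s2.
    by apply/allP => v; rewrite s2A inE => /andP[].
  apply: uniq_perm; rewrite ?filter_uniq ?permutations_uniq //.
    exact: shuffles_uniq as1 as2.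
  move=> s; rewrite mem_filter (mem_shuffles _ as1 as2).
  apply: andb_idr => /andP[/eqP fs1 /eqP fs2].
  have sE : perm_eq (s1 ++ s2) s by rewrite -fs1 -fs2 perm_filterC.
  apply: perms_mem => [|v].
    rewrite -(perm_uniq sE) cat_uniq us1 us2 andbT /=.
    by apply/hasPn => v; rewrite s1A s2A !inE => /andP[/negPf->]; rewrite andbF.
  rewrite -(perm_mem sE) mem_cat s1A s2A !inE.
  by case: (v \in a) (v \in A) => [] [].
under [RHS]eq_bigr => s1 _ do rewrite (exchange_big_dep xpredT) //=.
rewrite [RHS](exchange_big_dep xpredT) //= big_mkcond /=.
rewrite big_seq [RHS]big_seq; apply: eq_bigr => s sP.
have [fs1 fs2] := fP s sP.
transitivity (\sum_(s1 <- P1 | L1 s1 && (filter [in a] s == s1))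
  \sum_(s2 <- P2 | L2 s2 && (filter (predC [in a]) s == s2)) word (map l s)).
  rewrite !big_seq_pred1_if ?permutations_uniq // (linear_ext_filter _ Ea).
  by rewrite -/(L1 _) -/(L2 _); case: (L1 _).
rewrite big_mkcondr; apply: eq_big => [s1|s1 _]; first by rewrite andbT.
case: ifP => fss1.
  exact: eq_bigl.
by rewrite big_pred0 // => s2; rewrite andbF.
Qed.

(** * Congruence modulo the ideal *)
Lemma tauK (R : Type) : involutive (@tau R).
Proof. by move=> P; apply: val_inj; rewrite /= rev_rot rotrK revK. Qed.

Lemma weight_tau (R : Type) (P : polygon R) : weight (tau P) = weight P.
Proof. by rewrite /weight /tau /= size_rot size_rev. Qed.

Lemma mulr_nest (A : pzSemiRingType) (x y z t u : A) :
  x * (y * z * t) * u = x * y * z * (t * u).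
Proof. by rewrite !mulrA. Qed.

Section Congruence.
Variables (R : choiceType) (n : nat).
Implicit Types (x y z : Tpoly R) (Q : polygon R).

Definition cong x y : Prop := in_ideal n (x - y).

Lemma cong_refl x : cong x x.
Proof. by rewrite /cong subrr; apply: span0. Qed.

Lemma cong_sym x y : cong x y -> cong y x.
Proof.
move=> xy; rewrite /cong -(opprB x y) -[- _]add0r.
by apply: spanB xy; apply: span0.
Qed.

Lemma congB x y x' y' : cong x y -> cong x' y' -> cong (x - x') (y - y').
Proof.
move=> xy xy'; rewrite /cong; have -> : x - x' - (y - y') = x - y - (x' - y').
  by rewrite !opprB addrACA [RHS]addrACA (addrC (- x')).
exact: spanB.
Qed.

Lemma congD x y x' y' : cong x y -> cong x' y' -> cong (x + x') (y + y').
Proof.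
move=> xy xy'; rewrite -(opprK x') -(opprK y'); apply: (congB xy).
by rewrite -[- x']add0r -[- y']add0r; apply: congB => //; apply: cong_refl.
Qed.

Lemma cong_trans y x z : cong x y -> cong y z -> cong x z.
Proof.
by move=> xy yz; have := congD xy yz; rewrite /cong opprD addrA addrK.
Qed.

Lemma cong_sum (I : Type) (r : seq I) (P : pred I) (F G : I -> Tpoly R) :
  (forall i, P i -> cong (F i) (G i)) ->
  cong (\sum_(i <- r | P i) F i) (\sum_(i <- r | P i) G i).
Proof.
move=> FG; elim/big_ind2: _ => //; first exact: cong_refl.
by move=> *; apply: congD.
Qed.

Lemma congZ a x y : cong x y -> cong (a *: x) (a *: y).
Proof.
rewrite /cong -scalerBr => -[s sI ->].
exists [seq (a * p.1, p.2) | p <- s]; first by move=> _ /mapP[p /sI pI ->].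
by rewrite big_map scaler_sumr; apply: eq_bigr => p _; rewrite scalerA.
Qed.

Lemma scaleTr a x y : a *: (x * y) = x * (a *: y).
Proof.
apply/malgP => k; rewrite (mcoeffZ a (x * y) k) (mcoeffMl x y).
rewrite (mcoeffMlw _ (fsubset_refl _) (msuppZ_le a y)) mulr_sumr.
apply: eq_bigr => k1 _; rewrite mulr_sumr; apply: eq_bigr => k2 _.
by rewrite (mcoeffZ a y) mulrnAr mulrCA.
Qed.

Lemma congM z z' x y : cong x y -> cong (z * x * z') (z * y * z').
Proof.
rewrite /cong -mulrBl -mulrBr => -[s sI ->].
exists [seq (p.1, z * p.2 * z') | p <- s].
  move=> _ /mapP[p /sI [k [v [u [u' [kn vI ->]]]]] ->].
  by exists k, v, (z * u), (u' * z'); split; [exact: kn|exact: vI|exact: mulr_nest].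
rewrite big_map mulr_sumr mulr_suml; apply: eq_bigr => p _ /=.
by rewrite -scaleTr -scalerAl.
Qed.

(** The generator of [I_ k] attached to [tau Q] is [tau Q + (-1) ^+ k Q]. *)
Lemma cong_tau Q : (weight Q <= n)%N ->
  cong (word [:: tau Q]) ((-1) ^+ (weight Q).+1 *: word [:: Q]).
Proof.
move=> Qn; pose c : rat := (-1) ^+ weight Q.
exists [:: (1, word [:: tau Q] + c *: word [:: Q])]; last first.
  by rewrite big_seq1 scale1r exprS mulN1r scaleNr opprK.
move=> p; rewrite inE => /eqP-> /=.
exists (weight Q), (<< tau Q >> + c *: << Q >>), 1, 1; split.
- by rewrite Qn andbT /weight; have := sides_gt1 Q; lia.
- exists [:: (1, << tau Q >> + c *: << Q >>)]; last first.
    by rewrite big_seq1 scale1r.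
  move=> p'; rewrite inE => /eqP-> /=.
  by exists (tau Q); rewrite ?tauK ?weight_tau.
- by rewrite mul1r mulr1 letter_linearize linearD linearZ /= !linearizeU.
Qed.

Lemma cong_word (I : eqType) (s : seq I) (l l' : I -> polygon R)
    (c : I -> rat) :
  {in s, forall i, cong (word [:: l i]) (c i *: word [:: l' i])} ->
  cong (word (map l s)) ((\prod_(i <- s) c i) *: word (map l' s)).
Proof.
elim: s => [|i s IHs] ll'; first by rewrite big_nil scale1r; apply: cong_refl.
have lli := ll' i (mem_head _ _).
have {}IHs : cong (word (map l s)) ((\prod_(i <- s) c i) *: word (map l' s)).
  by apply: IHs => j js; apply: ll'; rewrite inE js orbT.
rewrite big_cons /= -(cat1s (l i)) -(cat1s (l' i)) !word_cat.
have := congM 1 (word (map l s)) lli; rewrite !mul1r => /cong_trans; apply.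
rewrite -scalerAl -scalerA; apply: congZ; rewrite scaleTr.
by have := congM (word [:: l' i]) 1 IHs; rewrite !mulr1.
Qed.

Lemma cong_Lambda (V : finType) (A : {set V}) (E : rel V)
    (l l' : V -> polygon R) (c : V -> rat) :
  {in A, forall v, cong (word [:: l v]) (c v *: word [:: l' v])} ->
  cong (Lambda (Forest A E l)) ((\prod_(v in A) c v) *: Lambda (Forest A E l')).
Proof.
move=> ll'; rewrite !LambdaE scaler_sumr big_seq_cond [X in cong _ X]big_seq_cond.
apply: cong_sum => s /andP[]; rewrite mem_permutations => sA _.
have -> : \prod_(v in A) c v = \prod_(v <- s) c v.
  by rewrite (perm_big _ sA) big_enum.
by apply: cong_word => v; rewrite (perm_mem sA) mem_enum; exact: ll'.
Qed.

End Congruence.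

(** * Turning round the spine of a tree *)
Section Telescope.
Variables (T : eqType) (st f : T -> nat).
Implicit Types (L : seq T).

Definition rising L := sorted ltn (map f L).
Definition falling L := sorted gtn (map f L).

Lemma sorted_mapP (g : rel nat) L :
  transitive g -> pairwise (relpre st ltn) L ->
  reflect {in L &, forall x y, (st x < st y)%N -> g (f x) (f y)}
    (sorted g (map f L)).
Proof.
move=> g_tr Lst; rewrite sorted_pairwise //; apply: (iffP idP).
  elim: L Lst => [|x L IHL] //= /andP[/allP xL /IHL {}IHL].
  move=> /andP[/allP gx /IHL gL] y z; rewrite !inE.
  case/predU1P=> [->|yL] /predU1P[->|zL]; try by rewrite ltnn.
  - by move=> _; apply: gx; apply: map_f.
  - by move/ltnW; rewrite leqNgt [(_ < _)%N]xL.
  - exact: gL.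
elim: L Lst => [|x L IHL] //= /andP[/allP xL /IHL {}IHL] H.
apply/andP; split.
  apply/allP => _ /mapP[y yL ->].
  by apply: H; rewrite ?inE ?eqxx ?yL ?orbT //; exact: xL.
by apply: IHL => y z yL zL; apply: H; rewrite inE ?yL ?zL orbT.
Qed.

(** Consider all ways of cutting the sequence in two, and whether [f] rises on
    the first part and falls on the second. The sum runs over the cuts before an
    element, and the right-hand side is the cut past the end. If some cut
    qualifies, exactly two do, just before and just after the maximum, and they
    carry opposite signs. *)
Lemma unimodal_telescope L : L != [::] ->
  pairwise (relpre st ltn) L -> uniq (map f L) ->
  \sum_(x <- L) (-1) ^+ count (fun y => (st x < st y)%N) L *
     (rising [seq y <- L | (st y < st x)%N] &&
      falling [seq y <- L | (st x <= st y)%N])%:R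
  = (rising L)%:R :> rat.
Proof.
pose term L x := (-1) ^+ count (fun y => (st x < st y)%N) L *
  (rising [seq y <- L | (st y < st x)%N] &&
   falling [seq y <- L | (st x <= st y)%N])%:R : rat.
have term_head x L1 : all (fun y => (st x < st y)%N) L1 ->
    term (x :: L1) x = (-1) ^+ size L1 * (falling (x :: L1))%:R.
  move=> xL; rewrite /term /= ltnn leqnn add0n.
  rewrite (eqP (etrans (esym (all_count _ _)) xL)).
  have -> : [seq y <- L1 | (st y < st x)%N] = [::].
    rewrite (@eq_in_filter _ _ pred0) ?filter_pred0 // => y /(allP xL).
    by case: ltngtP.
  suff -> : [seq y <- L1 | (st x <= st y)%N] = L1 by [].
  by apply/all_filterP; apply: sub_all xL => y; apply: ltnW.
have term_tail x z L1 : all (fun y => (st x < st y)%N) L1 -> z \in L1 ->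
    term (x :: L1) z = (-1) ^+ count (fun y => (st z < st y)%N) L1 *
  (rising (x :: [seq y <- L1 | (st y < st z)%N]) &&
   falling [seq y <- L1 | (st z <= st y)%N])%:R.
  move=> /allP xL zL; have xz : (st x < st z)%N := xL z zL.
  by rewrite /term /= xz ltnNge (ltnW xz) leqNgt xz.
elim: L => [|x [|y L] IHL] // _.
  by rewrite /term big_seq1 /= ltnn leqnn mul1r.
rewrite [pairwise _ _]/= => /andP[xL Lst].
rewrite [uniq _]/= => /andP[]; rewrite inE => /norP[fxy _] fu.
have {IHL} := IHL isT Lst fu.
rewrite -[LHS]/(\sum_(z <- y :: L) term (y :: L) z) => IHL.
rewrite -[LHS]/(\sum_(z <- x :: y :: L) term (x :: y :: L) z); move: IHL.
have yL : all (fun z => (st y < st z)%N) L by case/andP: Lst.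
rewrite !big_cons !term_head // => IHL.
rewrite term_tail ?mem_head //.
rewrite (eq_big_seq (fun z => (f x < f y)%N%:R * term (y :: L) z)); last first.
  move=> z zL; rewrite !term_tail ?inE ?zL ?orbT //=.
  have yz : (st y < st z)%N := allP yL z zL.
  rewrite yz [(st z < st y)%N]ltnNge (ltnW yz) [(st z <= st y)%N]leqNgt yz /=.
  rewrite add0n mulrCA -natrM mulnb andbA /rising /=; do 2!congr (_ * _).
rewrite -mulr_sumr; set S := \sum_(z <- L) _ in IHL *.
move/(canRL (addKr _)): IHL => ->.
have -> : count (fun z => (st y < st z)%N) (y :: L) = size L.
  by rewrite /= ltnn (eqP (etrans (esym (all_count _ _)) yL)).
have -> : [seq z <- y :: L | (st z < st y)%N] = [::].
  rewrite /= ltnn (@eq_in_filter _ _ pred0) ?filter_pred0 // => z /(allP yL).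
  by case: ltngtP.
have -> : [seq z <- y :: L | (st y <= st z)%N] = y :: L.
  rewrite /= leqnn; congr cons.
  by apply/all_filterP; apply: sub_all yL => z; apply: ltnW.
rewrite exprS /rising /falling /=.
by case: (ltngtP (f x) (f y)) fxy => //= xy _; ring.
Qed.
End Telescope.

Section Spine.
Local Open Scope nat_scope.
Variable n : nat.
Notation arr := (arrow n.+1).
Implicit Types (a b c : arr) (d : {set arr}) (r : option arr) (m : nat).

Definition to_root a : bool := a.2 == n :> nat.

(** The regions meeting the root side. They form a path starting at the root
    of the tree, whose edges are the arrows ending on the root side. *)
Definition spine r : bool := if r is Some a then to_root a else true.
Definition start r : nat := if r is Some a then lo a else 0.

(** Reflecting or cutting a dissection leaves these edges unchanged; only the
    edges of the spine are affected. *)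
Definition rib d r r' : bool := region_edge d r r' && ~~ spine r'.
Definition bent m r r' : bool :=
  [&& spine r, spine r'
    & (start r < start r' < m) || (m <= start r' < start r)].

(** The tree of [d], with its spine turned round from position [m] on. As far as
    orderings are concerned, a large [m] gives back the tree of [d], [m = 0] the
    tree of the mirror image, and [m = lo a], for an arrow [a] of [d] ending on
    the root side, the disjoint union of the trees of the root polygon and of
    the reflected cut-off polygon of [a]. *)
Definition folded d m r r' : bool := rib d r r' || bent m r r'.

Lemma lo_hi_inj a b : lo a = lo b -> hi a = hi b -> a = b.
Proof.
case: a b => [i j] [i' j']; rewrite /lo /hi /spos /= => l h.
by congr pair; apply: val_inj => /=; lia.
Qed.

Lemma lo_lt_hi a : lo a < hi a.
Proof. by rewrite /lo /hi /spos; lia. Qed.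

Lemma hi_le a : hi a <= n.*2.+1.
Proof. by have := ltn_ord a.1; have := ltn_ord a.2; rewrite /hi /spos; lia. Qed.

Lemma to_root_hi a : to_root a = (hi a == n.*2.+1).
Proof.
by have := ltn_ord a.1; have := ltn_ord a.2; rewrite /to_root /hi /spos; lia.
Qed.

Lemma to_root_lo a : to_root a -> lo a = a.1.*2.
Proof. by have := ltn_ord a.1; rewrite /to_root /lo /spos; lia. Qed.

Lemma nontrivial_root a : nontrivial a -> to_root a -> 0 < a.1 < n.
Proof.
move=> /nontrivial_neq[]; have := ltn_ord a.1; have := ltn_ord a.2.
rewrite /to_root; lia.
Qed.

Lemma to_rootE a : to_root a -> lo a = a.1.*2 /\ hi a = n.*2.+1.
Proof.
by move=> ar; rewrite to_root_lo //; split=> //; apply/eqP; rewrite -to_root_hi.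
Qed.

Lemma mem_regions d r :
  (r \in regions d) = if r is Some a then a \in d else true.
Proof.
rewrite /regions !inE; case: r => [a|] //=.
by rewrite mem_imset //; exact: Some_inj.
Qed.

Lemma crossingN a b : crossing a b = false ->
  [|| hi a <= lo b, hi b <= lo a, (lo a <= lo b) && (hi b <= hi a)
    | (lo b <= lo a) && (hi a <= hi b)].
Proof.
rewrite /crossing; have := lo_lt_hi a; have := lo_lt_hi b.
move: (lo a) (hi a) (lo b) (hi b); lia.
Qed.

Lemma beyond_trans : transitive (@beyond n.+1).
Proof.
move=> b a c /and3P[ba l1 h1] /and3P[cb l2 h2]; apply/and3P; split; try lia.
apply/negP => /eqP ca; rewrite ca in l2 h2; case/eqP: ba.
by apply: lo_hi_inj; lia.
Qed.

Lemma beyond_width a b : beyond a b -> hi b - lo b < hi a - lo a.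
Proof.
case/and3P=> /eqP ba l h; have lhb := lo_lt_hi b; have lha := lo_lt_hi a.
have [hE|/eqP] := eqVneq (hi a - lo a) (hi b - lo b); last lia.
by case: ba; apply: lo_hi_inj; lia.
Qed.

(** An arrow beyond a region is reached from it by a chain of edges: insert
    intermediate arrows of [d] as long as there are some. *)
Lemma region_edge_index d s :
  linear_ext (regions d) (region_edge d) s ->
  {in regions d, forall r, {in d, forall a, beyondr r a ->
     index r s < index (Some a) s}}.
Proof.
move/linear_extP => H r rd a ad ra.
(* No arrow is as wide as the value given to the root region. *)
pose w r := if r is Some b then hi b - lo b else n.*2.+2.
have [k] := ubnP (w r - w (Some a)).
elim: k r rd a ad ra => // k IHk r rd a ad ra wk.
have [/existsP[c /and3P[cd rc ca]]|/existsPn none] :=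
  boolP [exists c, [&& c \in d, beyondr r c & beyond c a]].
  have wca := beyond_width ca.
  have wrc : hi c - lo c < w r.
    by case: (r) rc => [b|] /=; [exact: beyond_width|have := hi_le c; lia].
  have cr : Some c \in regions d by rewrite mem_regions.
  move: wk => /= wk.
  apply: (@ltn_trans (index (Some c) s)); apply: IHk => //=; lia.
apply: H => //; first by rewrite mem_regions.
rewrite /= ra; apply/forallP => c; apply/implyP => cd.
by move: (none c); rewrite cd.
Qed.

(** The edges between spine regions only join consecutive ones, but by
    [region_edge_index] they order all of them. *)
Lemma linear_ext_folded d s : dissection d ->
  linear_ext (regions d) (region_edge d) s
  = linear_ext (regions d) (folded d n.*2.+1) s.
Proof.
move=> /dissectionP[dN dX]; apply/idP/idP => [H|/linear_extP H].
  have HB := region_edge_index H; move/linear_extP: H => H.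
  apply/linear_extP => r r' rd r'd /orP[/andP[rr' _]|]; first exact: H.
  case: r' r'd => [a|] ad /and3P[rS r'S st]; last by move: st => /=; lia.
  rewrite mem_regions in ad; apply: (HB r rd a ad).
  case: r rd rS st => //= b bd bS; have := hi_le a.
  have [lb hb] := to_rootE bS; rewrite /beyond hb => ha st.
  apply/and3P; split=> //; last by have := lo_lt_hi a; have := hi_le a; lia.
  by apply/eqP => ab; rewrite ab in st; have := hi_le b; lia.
apply/linear_extP => r r' rd r'd e; apply: H => //; rewrite /folded /rib e /=.
case: r' e r'd => [a|] //= /andP[ra _]; rewrite mem_regions => ad.
case ar: (to_root a) => //=; rewrite /bent /= ar /=.
have [la ha] := to_rootE ar; have := nontrivial_root (dN a ad) ar.
case: r rd ra => [b|] /=; last by rewrite la; lia.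
rewrite mem_regions => bd /and3P[/eqP ab l h] /= a1.
have br : to_root b by rewrite to_root_hi; have := hi_le b; lia.
have [lb hb] := to_rootE br.
have : lo b <> lo a by move=> lE; apply: ab; apply: lo_hi_inj; lia.
by rewrite br /=; lia.
Qed.

End Spine.

Lemma linear_ext_or (V : finType) (A : {set V}) (E E' : rel V) s :
  linear_ext A (fun u v => E u v || E' u v) s
  = linear_ext A E s && linear_ext A E' s.
Proof.
apply/linear_extP/andP => [H|[/linear_extP H /linear_extP H'] u v uA vA].
  by split; apply/linear_extP => u v uA vA e; apply: H; rewrite // e ?orbT.
by case/orP; [apply: H|apply: H'].
Qed.

Lemma gtn_trans : transitive gtn.
Proof. by move=> b a c /= ba cb; apply: ltn_trans cb ba. Qed.

Section SpineTelescope.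
Variables (n : nat) (d : {set arrow n.+1}).
Hypothesis dD : dissection d.
Notation arr := (arrow n.+1).

Definition root_arrows : {set arr} := [set a in d | to_root a].

(** Sorted by starting vertex, so that [spine_seq] lists the spine from the
    root on. *)
Definition spine_arrows : seq arr :=
  sort (relpre (@lo _) leq) (enum root_arrows).
Definition spine_seq : seq (option arr) := None :: map Some spine_arrows.

Lemma mem_spine_arrows a : (a \in spine_arrows) = (a \in d) && to_root a.
Proof. by rewrite mem_sort mem_enum inE. Qed.

Lemma mem_spine_seq r : (r \in spine_seq) = (r \in regions d) && spine r.
Proof.
rewrite inE mem_regions; case: r => [a|] //=.
by rewrite mem_map ?mem_spine_arrows //; exact: Some_inj.
Qed.

Lemma spine_seq_start : pairwise (relpre (@start n) ltn) spine_seq.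
Proof.
have [dN _] := elimT (dissectionP d) dD.
rewrite /=; apply/andP; split.
  rewrite all_map; apply/allP => a; rewrite mem_spine_arrows => /andP[ad ar] /=.
  by rewrite to_root_lo //; have := nontrivial_root (dN a ad) ar; lia.
rewrite pairwise_map -(@pairwise_map _ _ (@lo n.+1) ltn) -sorted_pairwise;
  last exact: ltn_trans.
rewrite ltn_sorted_uniq_leq map_inj_in_uniq ?sort_uniq ?enum_uniq /=; last first.
  move=> a b; rewrite !mem_spine_arrows => /andP[_ ar] /andP[_ br] ab.
  by apply: lo_hi_inj => //; rewrite !(to_rootE _).2.
by rewrite sorted_map; apply: sort_sorted => a b; apply: leq_total.
Qed.

Lemma linear_ext_bent m s :
  linear_ext (regions d) (@bent n m) s =
  rising (index^~ s) [seq r <- spine_seq | (start r < m)%N] &&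
  falling (index^~ s) [seq r <- spine_seq | (m <= start r)%N].
Proof.
have fpw (p : pred (option arr)) :
    pairwise (relpre (@start n) ltn) (filter p spine_seq).
  by apply: (subseq_pairwise _ spine_seq_start); apply: filter_subseq.
rewrite /rising /falling; apply/linear_extP/andP => [H|[
  /(sorted_mapP _ ltn_trans (fpw _)) Hr /(sorted_mapP _ gtn_trans (fpw _)) Hf]].
  split.
    apply/(sorted_mapP _ ltn_trans (fpw _)) => r r'.
    rewrite !mem_filter !mem_spine_seq => /and3P[rm rd rS] /and3P[r'm r'd r'S] rr'.
    by apply: H; rewrite // /bent rS r'S rr' r'm.
  apply/(sorted_mapP _ gtn_trans (fpw _)) => r r'.
  rewrite !mem_filter !mem_spine_seq => /and3P[rm rd rS] /and3P[r'm r'd r'S] rr'.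
  by apply: H; rewrite // /bent rS r'S rr' rm orbT.
move=> r r' rd r'd /and3P[rS r'S /orP[/andP[rr' r'm]|/andP[mr' r'r]]].
  have rm := ltn_trans rr' r'm.
  by apply: (Hr r r' _ _ rr'); rewrite mem_filter mem_spine_seq /=
    ?rd ?r'd ?rS ?r'S ?rm ?r'm.
have mr := leq_trans mr' (ltnW r'r).
by apply: (Hf r' r _ _ r'r); rewrite mem_filter mem_spine_seq /=
  ?rd ?r'd ?rS ?r'S ?mr ?mr'.
Qed.

Lemma linear_ext_telescope s : s \in permutations (enum (regions d)) ->
  \sum_(a in root_arrows) (-1) ^+ #|[set b in root_arrows | (lo a < lo b)%N]| *
     (linear_ext (regions d) (folded d (lo a)) s)%:R
  = (linear_ext (regions d) (folded d n.*2.+1) s)%:R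
    - (-1) ^+ #|root_arrows| * (linear_ext (regions d) (folded d 0) s)%:R :> rat.
Proof.
move=> /mem_perms[su sR].
have uidx : uniq (map (index^~ s) spine_seq).
  rewrite map_inj_in_uniq => [|r r'].
    apply: (map_uniq (f := @start n)); apply: sorted_uniq ltn_trans ltnn _ _.
    by rewrite sorted_map; apply: pairwise_sorted spine_seq_start.
  rewrite !mem_spine_seq -!sR => /andP[rs _] /andP[r's _].
  exact: index_inj.
have := unimodal_telescope (isT : spine_seq != [::]) spine_seq_start uidx.
have perm_sp : perm_eq spine_arrows (enum root_arrows).
  by rewrite /spine_arrows perm_sort.
have count_sp (p : pred arr) :
    count p spine_arrows = #|[set a in root_arrows | p a]|.
  by rewrite (permP perm_sp) -sum1_count big_enum_cond sum1dep_card.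
have ext m : linear_ext (regions d) (folded d m) s =
    linear_ext (regions d) (rib d) s &&
    (rising (index^~ s) [seq r <- spine_seq | (start r < m)%N] &&
     falling (index^~ s) [seq r <- spine_seq | (m <= start r)%N]).
  by rewrite -linear_ext_bent -linear_ext_or.
case rib_s: (linear_ext (regions d) (rib d) s); last first.
  move=> _; rewrite !ext rib_s mulr0 subr0 big1 // => a _.
  by rewrite ext rib_s mulr0.
have spine_lo r : r \in spine_seq -> (start r < n.*2.+1)%N.
  rewrite mem_spine_seq => /andP[_]; case: r => //= a ar.
  by rewrite to_root_lo //; have := ltn_ord a.1; lia.
have cnt a : count (fun r => lo a < start r)%N spine_seq
    = #|[set b in root_arrows | (lo a < lo b)%N]|.
  by rewrite /= add0n count_map -count_sp.
have cnt0 : count (fun r => 0 < start r)%N spine_seq = #|root_arrows|.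
  rewrite /= add0n count_map cardE -(perm_size perm_sp) -size_filter.
  congr size; apply/all_filterP/allP => a; rewrite mem_spine_arrows /=.
  move=> /andP[ad ar]; rewrite to_root_lo //.
  have [dN _] := elimT (dissectionP d) dD.
  by have := nontrivial_root (dN a ad) ar; lia.
rewrite {1}/spine_seq big_cons big_map cnt0 => tel.
rewrite -big_enum -(perm_big _ perm_sp) /=.
under eq_bigr => a _ do rewrite ext rib_s -cnt.
rewrite [RHS]addrC; apply/(canRL (addKr _)); rewrite !ext rib_s.
have all_lt : [seq r <- spine_seq | (start r < n.*2.+1)%N] = spine_seq.
  by apply/all_filterP/allP.
have none_ge : [seq r <- spine_seq | (n.*2.+1 <= start r)%N] = [::].
  rewrite (@eq_in_filter _ _ pred0) ?filter_pred0 // => r /spine_lo.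
  by rewrite ltnNge => /negPf.
by rewrite all_lt none_ge andbT -tel.
Qed.

(** [unimodal_telescope] for the places of the spine regions in an ordering;
    the ribs impose the same condition on all terms. *)
Lemma Lambda_telescope (R : choiceType) (l : option arr -> polygon R) :
  \sum_(a in root_arrows) (-1) ^+ #|[set b in root_arrows | (lo a < lo b)%N]| *:
     Lambda (Forest (regions d) (folded d (lo a)) l)
  = Lambda (Forest (regions d) (folded d n.*2.+1) l)
    - (-1) ^+ #|root_arrows| *: Lambda (Forest (regions d) (folded d 0) l).
Proof.
have LE m : Lambda (Forest (regions d) (folded d m) l) =
  \sum_(s <- permutations (enum (regions d)))
    (linear_ext (regions d) (folded d m) s)%:R *: word (map l s).
  rewrite LambdaE big_mkcond; apply: eq_bigr => s _.
  by case: ifP; rewrite ?scale1r ?scale0r.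
rewrite !LE; under eq_bigr => a _ do rewrite LE scaler_sumr.
rewrite exchange_big scaler_sumr -sumrB big_seq [RHS]big_seq /=.
apply: eq_bigr => s sP; rewrite scalerA -scalerBl -(linear_ext_telescope sP).
by rewrite scaler_suml; apply: eq_bigr => a _; rewrite scalerA.
Qed.

End SpineTelescope.

(** * Sides, labels and weights of regions *)
Section Traces.
Variable n : nat.
Notation arr := (arrow n.+1).
Implicit Types (a b c : arr) (d : {set arr}) (r : option arr) (k : 'I_n.+1).

Definition trace d r : seq 'I_n.+1 := [seq k <- enum 'I_n.+1 | on_region d r k].

Definition reversed r : bool := if r is Some a then backwards a else false.

Definition wt d r : nat := (size (trace d r)).-1.

Definition sgn d : rat := \prod_(a in d | backwards a) (-1) ^+ wt d (Some a).

Lemma region_sidesE d r :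
  region_sides d r = if reversed r then rot 1 (trace d r) else trace d r.
Proof. by case: r. Qed.

Lemma size_trace_gt1 d r : dissection d -> r \in regions d -> (1 < n.+1)%N ->
  (1 < size (trace d r))%N.
Proof.
move=> dD rd n1; have := region_sides_gt1 n1 dD rd; rewrite region_sidesE.
by case: ifP; rewrite ?size_rot.
Qed.

End Traces.

Section Labels.
Variables (R : Type) (P0 : polygon R).

Lemma mkpolyE (s : seq R) : (1 < size s)%N -> mkpoly P0 s = s :> seq R.
Proof. by move=> s1; rewrite /mkpoly -[sides _]/(val _) insubdK. Qed.

(** The subpolygon beyond a backwards arrow is its list of sides rotated by one,
    and [tau] undoes this rotation: what remains is the reversal of the list. *)
Definition lab n (x : 'I_n.+1 -> R) (d : {set arrow n.+1}) r : polygon R :=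
  mkpoly P0 (map x (if reversed r then rev (trace d r) else trace d r)).

Lemma sides_lab n (x : 'I_n.+1 -> R) (d : {set arrow n.+1}) r :
  dissection d -> r \in regions d -> (1 < n.+1)%N ->
  lab x d r = map x (if reversed r then rev (trace d r) else trace d r) :> seq R.
Proof.
move=> dD rd n1; apply: mkpolyE; rewrite size_map.
by case: ifP; rewrite ?size_rev size_trace_gt1.
Qed.

Lemma weight_lab n (x : 'I_n.+1 -> R) (d : {set arrow n.+1}) r :
  dissection d -> r \in regions d -> (1 < n.+1)%N -> weight (lab x d r) = wt d r.
Proof.
move=> dD rd n1; rewrite /weight sides_lab // size_map /wt.
by case: ifP; rewrite ?size_rev.
Qed.

End Labels.

(** The polygon enters through the labels of its sides only. Indexing them by
    ['I_n.+1] allows polygons of provably equal sizes to share one type of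
    arrows. *)
Definition Lambda_sides (R : choiceType) (P0 : polygon R) n
    (x : 'I_n.+1 -> R) : Tpoly R :=
  \sum_(d : {set arrow n.+1} | dissection d)
    sgn d *: Lambda (Forest (regions d) (folded d n.*2.+1) (lab P0 x d)).

Lemma Lambda_phi2E (R : choiceType) (P0 P : polygon R) n (x : 'I_n.+1 -> R) :
  (sides P = map x (enum 'I_n.+1)) -> Lambda_phi2 P = Lambda_sides P0 x.
Proof.
move=> Px; have sP := sides_gt1 P.
have n1 : (1 < n.+1)%N by move: sP; rewrite Px size_map size_enum_ord.
pose labT N (y : 'I_N -> R) (d : {set arrow N}) r :=
  let Q := mkpoly P (map y (region_sides d r)) in
  if r is Some a then if backwards a then tau Q else Q else Q.
pose LamT N (y : 'I_N -> R) := \sum_(d : {set arrow N} | dissection d)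
  (\prod_(a in d | backwards a) (-1) ^+ weight (labT N y d (Some a)) : rat)
    *: Lambda (Forest (regions d) (region_edge d) (labT N y d)).
(* In this form the number of sides can be replaced by n.+1. *)
have -> : Lambda_phi2 P = LamT (size P) (tnth (in_tuple P)) by [].
have : map (tnth (in_tuple P)) (enum 'I_(size P)) = map x (enum 'I_n.+1).
  by rewrite -Px -[RHS](map_tnth_enum (in_tuple P)).
have : size P = n.+1 by rewrite Px size_map size_enum_ord.
move: (size P) (tnth _) => N y NE; subst N => yx.
have {}yx : y =1 x.
  by move=> k; move/eq_in_map: yx; apply; rewrite mem_enum.
apply: eq_bigr => d dD.
have lE r : r \in regions d -> labT _ y d r = lab P0 x d r.
  move=> rd; apply: val_inj; rewrite /= sides_lab //.
  have s1 : (1 < size (map y (region_sides d r)))%N.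
    by rewrite size_map region_sides_gt1.
  rewrite -(eq_map yx).
  move: s1; rewrite /labT region_sidesE.
  case: r rd => [a|] rd /= s1; last by rewrite mkpolyE.
  case: ifP s1 => _ s1; last by rewrite mkpolyE.
  by rewrite /= mkpolyE // map_rot rev_rot rotrK map_rev.
congr (_ *: _).
  apply: eq_bigr => a /andP[ad _]; rewrite lE ?mem_regions //.
  by rewrite weight_lab ?mem_regions.
rewrite (@eq_Lambda _ _ _ _ (region_edge d) _ (lab P0 x d)) // !LambdaE.
by apply: eq_bigl => s; apply: linear_ext_folded.
Qed.

Section WeightSum.
Local Open Scope nat_scope.
Variables (n : nat) (d : {set arrow n.+1}).
Hypothesis dD : dissection d.
Notation arr := (arrow n.+1).
Implicit Types (a b c : arr) (r : option arr) (k : 'I_n.+1).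

Definition root_side r : 'I_n.+1 := if r is Some a then a.2 else ord_max.

Definition covers a k : bool := lo a < spos k < hi a.

Lemma on_region_root_side r : on_region d r (root_side r).
Proof.
rewrite /on_region; apply/andP; split.
  by case: r => //= a; rewrite /lo /hi; clear; lia.
apply/forallP => b; apply/implyP => bd; apply/implyP.
case: r => [a|_] /=; last by have := hi_le b; rewrite /spos /=; clear; lia.
by move=> /and3P[_ + +]; rewrite /lo /hi /spos; clear; lia.
Qed.

Lemma on_region_inner r k :
  (on_region d r k && (k != root_side r)) =
  (if r is Some a then covers a k else k != ord_max) &&
  [forall b in d, beyondr r b ==> ~~ covers b k].
Proof.
rewrite /on_region andbAC; congr (_ && _).
case: r => [[i j]|] //=; rewrite -(inj_eq val_inj) /= /covers /lo /hi /spos /=.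
move: (k : nat) (i : nat) (j : nat) => u v w; clear; lia.
Qed.

(** The region is the one beyond the innermost arrow covering the side, or else
    the root region; uniqueness holds because two arrows of [d] covering the
    same side are nested. *)
Lemma region_of_side k : k != ord_max ->
  exists2 r, r \in regions d & forall r', r' \in regions d ->
    (on_region d r' k && (k != root_side r')) = (r' == r).
Proof.
move=> kn; have [/existsP[a0 /andP[a0d a0k]]|/existsPn none] :=
    boolP [exists a, (a \in d) && covers a k].
  pose Q a := (a \in d) && covers a k.
  have Qa0 : Q a0 by rewrite /Q a0d.
  case: (arg_minnP (fun a => hi a - lo a) Qa0) => a /andP[ad ak] amin.
  exists (Some a) => [|r]; first by rewrite mem_regions.
  rewrite mem_regions on_region_inner; case: r => [b|_].
    move=> bd; apply/andP/eqP => [[bk /forallP bmin]|[->]]; last first.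
      split=> //; apply/forallP => c; apply/implyP => cd; apply/implyP => /= ac.
      apply/negP => ck; have := amin c; rewrite /Q cd ck => /(_ isT).
      by rewrite leqNgt beyond_width.
    congr Some; apply/eqP/negPn/negP => ba.
    have Nba : beyond b a = false.
      by apply/negP => bea; have := bmin a; rewrite ad /= bea ak.
    have Nab : beyond a b = false.
      apply/negP => abe; have := amin b; rewrite /Q bd bk => /(_ isT).
      by rewrite leqNgt beyond_width.
    have [_ dX] := elimT (dissectionP d) dD.
    have := crossingN (negbTE (dX a b ad bd)); move: ak bk Nab Nba.
    rewrite /beyond [a == b]eq_sym (negPf ba) /covers /=.
    move: (lo a) (hi a) (lo b) (hi b) (spos k); clear; lia.
  rewrite kn /=; apply/negP => /forallP /(_ a); by rewrite ad ak.
exists None => [|r]; first by rewrite mem_regions.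
rewrite mem_regions on_region_inner; case: r => [b bd|_].
  by move: (none b); rewrite bd /= => /negPf->.
rewrite kn eqxx /=; apply/forallP => b; apply/implyP => bd.
by move: (none b); rewrite bd.
Qed.

Lemma wtE r : wt d r = \sum_k (on_region d r k && (k != root_side r)).
Proof.
rewrite /wt /trace size_filter -sum1_count big_enum_cond /=.
rewrite (bigD1 (root_side r)) ?on_region_root_side //= big_mkcond /=.
by apply: eq_bigr => k _; case: ifP.
Qed.

(** The weight of a region is the number of its sides other than its root side,
    and each side other than the root side of the whole polygon is counted
    once. *)
Lemma sum_wt : \sum_(r in regions d) wt d r = n.
Proof.
under eq_bigr do rewrite wtE.
rewrite exchange_big /= (bigD1 ord_max) //= big1 ?add0n; last first.
  move=> r _; rewrite on_region_inner; case: r => [a|]; rewrite ?eqxx //.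
  rewrite /covers; have := hi_le a; rewrite /spos /=.
  by case: andP => //; lia.
rewrite (eq_bigr (fun=> 1)); last first.
  move=> k /region_of_side[r rd rP].
  rewrite (bigD1 r) //= rP // eqxx big1 // => r' /andP[r'd /negPf r'r].
  by rewrite rP // r'r.
by rewrite sum1_card cardC1 card_ord.
Qed.

End WeightSum.

(** * Reflection of dissections *)
Section Mirror.
Local Open Scope nat_scope.
Variable n : nat.
Notation arr := (arrow n.+1).
Implicit Types (a b c : arr) (d : {set arr}) (r : option arr) (k : 'I_n.+1).

Definition mirror_side k : 'I_n.+1 :=
  inord (if k == n :> nat then n else n.-1 - k).

(** Since the root side is fixed, arrows ending there stay forwards, whereas all
    others change direction: this is why only labels on the spine change in
    [lab_mirror_region]. *)
Definition mirror a : arr := (rev_ord a.1, mirror_side a.2).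

Lemma val_mirror_side k :
  mirror_side k = (if k == n :> nat then n else n.-1 - k) :> nat.
Proof. by rewrite /mirror_side inordK //; have := ltn_ord k; case: ifP; lia. Qed.

Lemma mirror_sideK : involutive mirror_side.
Proof.
move=> k; apply: val_inj; rewrite /= !val_mirror_side; have := ltn_ord k.
by move: (k : nat) => u; do 2!case: ifP; lia.
Qed.

Lemma mirrorK : involutive mirror.
Proof. by case=> i j; rewrite /mirror /= rev_ordK mirror_sideK. Qed.

Definition mirror_inj := inv_inj mirrorK.

Lemma mirror_to_root a : to_root (mirror a) = to_root a.
Proof.
rewrite /to_root /= val_mirror_side; have := ltn_ord a.2.
by move: (a.2 : nat) => u; case: ifP; lia.
Qed.

Lemma mirror_root a : to_root a -> lo (mirror a) = n.*2 - lo a.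
Proof.
move=> ar; rewrite !to_root_lo ?mirror_to_root //=; have := ltn_ord a.1.
by clear; lia.
Qed.

Lemma mirror_nonroot a : ~~ to_root a ->
  [/\ lo (mirror a) = n.*2 - hi a, hi (mirror a) = n.*2 - lo a & hi a <= n.*2].
Proof.
case: a => i j; rewrite /to_root /lo /hi /spos /= val_mirror_side.
move=> /[dup] jn /negPf->; have := ltn_ord i; have := ltn_ord j; move: jn.
by move: (i : nat) (j : nat); clear => u v; split; lia.
Qed.

Lemma mirror_spos k : k != ord_max ->
  spos (mirror_side k) = n.*2 - spos k /\ spos k < n.*2.
Proof.
rewrite -(inj_eq val_inj) /= /spos val_mirror_side => /[dup] kn /negPf->.
by have := ltn_ord k; move: kn; move: (k : nat); clear; lia.
Qed.

Lemma mirror_side_max k : (mirror_side k == ord_max) = (k == ord_max).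
Proof.
rewrite -!(inj_eq val_inj) /= val_mirror_side; have := ltn_ord k.
by move: (k : nat) => u; case: ifP; lia.
Qed.

Lemma nontrivialE a : nontrivial a =
  [&& a.2 != a.1 :> nat, a.2.+1 != a.1 :> nat
    & ~~ ((a.1 == 0 :> nat) && (a.2 == n :> nat))].
Proof.
rewrite /nontrivial; have iN := ltn_ord a.1; have jN := ltn_ord a.2.
rewrite (modn_small iN) (modn_small jN).
have [jE|jn] := eqVneq (a.2 : nat) n.
  rewrite jE modnn; move: (a.1 : nat) iN => u; clear; lia.
have jn' : a.2.+1 < n.+1 by move: jN jn; move: (a.2 : nat); clear; lia.
by rewrite (modn_small jn') andbF andbT.
Qed.

Lemma mirror_nontrivial a : nontrivial (mirror a) = nontrivial a.
Proof.
rewrite !nontrivialE /= val_mirror_side; have := ltn_ord a.1.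
have := ltn_ord a.2; move: (a.1 : nat) (a.2 : nat); clear => u v.
by case: ifP; lia.
Qed.

Lemma mirror_crossing a b : crossing (mirror a) (mirror b) = crossing a b.
Proof.
rewrite /crossing; have la := lo_lt_hi a; have lb := lo_lt_hi b.
have [ar|/mirror_nonroot[-> -> ha]] := boolP (to_root a).
  have ar' := ar; rewrite -mirror_to_root in ar'.
  have [_ ha'] := to_rootE ar'; have [lla ha] := to_rootE ar.
  have := ltn_ord a.1.
  rewrite ha' ha mirror_root //.
  have [br|/mirror_nonroot[-> -> hb]] := boolP (to_root b).
    have br' := br; rewrite -mirror_to_root in br'.
    have [_ hb'] := to_rootE br'; have [llb hb] := to_rootE br.
    rewrite hb' hb; move: (lo _) (lo _); clear; lia.
  move: lla la lb hb; rewrite ha; move: (lo a) (lo b) (hi b) (a.1 : nat).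
  by clear; lia.
have [br|/mirror_nonroot[-> -> hb]] := boolP (to_root b).
  have br' := br; rewrite -mirror_to_root in br'.
  have [_ hb'] := to_rootE br'; have [llb hb] := to_rootE br.
  have := ltn_ord b.1; move: llb la lb ha.
  rewrite hb' hb mirror_root //.
  by move: (lo a) (lo b) (hi a) (b.1 : nat); clear; lia.
move: la lb ha hb.
by move: (lo a) (lo b) (hi a) (hi b); clear; lia.
Qed.

(** If [b] ends on the root side, neither side holds. If [a] did, the reflection
    would exchange the two sides of [a]. *)
Lemma mirror_beyond a b : ~~ to_root a ->
  beyond (mirror a) (mirror b) = beyond a b.
Proof.
move=> /mirror_nonroot[la ha hna]; rewrite /beyond la ha (inj_eq mirror_inj).
have [br|/mirror_nonroot[-> -> hb]] := boolP (to_root b).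
  have br' := br; rewrite -mirror_to_root in br'.
  have [_ ->] := to_rootE br'; have [_ ->] := to_rootE br.
  by congr (_ && _); move: hna; clear; lia.
congr (_ && _); have := lo_lt_hi a; have := lo_lt_hi b; move: hna hb.
by move: (lo a) (lo b) (hi a) (hi b); clear; lia.
Qed.

Lemma mem_mirror d a : (mirror a \in mirror @: d) = (a \in d).
Proof. by rewrite mem_imset //; apply: mirror_inj. Qed.

Lemma imset_mirrorK d : mirror @: (mirror @: d) = d.
Proof.
rewrite -imset_comp -[RHS]imset_id; apply: eq_imset; exact: mirrorK.
Qed.

Lemma forall_mirror d (p : pred arr) :
  [forall a in mirror @: d, p a] = [forall a in d, p (mirror a)].
Proof.
apply/forallP/forallP => H a; apply/implyP => ad.
  by apply: (implyP (H _)); rewrite mem_mirror.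
by rewrite -[a]mirrorK; apply: (implyP (H _)); rewrite -mem_mirror mirrorK.
Qed.

Lemma mirror_dissection d : dissection (mirror @: d) = dissection d.
Proof.
rewrite /dissection !forall_mirror; congr (_ && _).
  by apply: eq_forallb => a; rewrite mirror_nontrivial.
apply: eq_forallb => a; rewrite forall_mirror; congr (_ ==> _).
by apply: eq_forallb => b; rewrite mirror_crossing.
Qed.

End Mirror.

Section NextRoot.
Local Open Scope nat_scope.
Variables (n : nat) (d : {set arrow n.+1}).
Hypothesis dD : dissection d.
Notation arr := (arrow n.+1).
Implicit Types (a b c : arr) (r : option arr) (k : 'I_n.+1).

Let dN a : a \in d -> nontrivial a.
Proof. by case: (elimT (dissectionP d) dD) => dN _ /dN. Qed.

Let dX a b : a \in d -> b \in d -> crossing a b = false.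
Proof.
by case: (elimT (dissectionP d) dD) => _ dX ad bd; apply/negbTE; apply: dX.
Qed.

Definition is_next r b : bool :=
  [&& b \in root_arrows d, start r < lo b
    & [forall c in root_arrows d, (start r < lo c) ==> (lo b <= lo c)]].

Definition next_root r : option arr := [pick b | is_next r b].

(** A spine region occupies the boundary between the starting points of two
    consecutive arrows to the root side; [start] and [finish] are these two
    points, vertices 0 and [n] being added at the ends. *)
Definition finish r : nat := if next_root r is Some b then lo b else n.*2.

Lemma root_arrow_lo a : a \in root_arrows d ->
  [/\ a \in d, to_root a, 0 < lo a, lo a < n.*2 & hi a = n.*2.+1].
Proof.
rewrite inE => /andP[ad ar]; have [la ha] := to_rootE ar.
have := nontrivial_root (dN ad) ar; rewrite la; split=> //.
  by move: (a.1 : nat) H; clear; lia.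
by move: (a.1 : nat) H; clear; lia.
Qed.

Lemma root_arrow_inj a b : a \in root_arrows d -> b \in root_arrows d ->
  lo a = lo b -> a = b.
Proof.
move=> /root_arrow_lo[_ _ _ _ ha] /root_arrow_lo[_ _ _ _ hb] ab.
by apply: lo_hi_inj; rewrite // ha hb.
Qed.

Lemma is_nextP r b : reflect
  [/\ b \in root_arrows d, start r < lo b
    & {in root_arrows d, forall c, start r < lo c -> lo b <= lo c}]
  (is_next r b).
Proof.
apply: (iffP and3P) => -[bd rb bmin]; split=> //.
  by move=> c cd rc; move/forallP: bmin => /(_ c)/implyP/(_ cd)/implyP/(_ rc).
by apply/forallP => c; apply/implyP => cd; apply/implyP; apply: bmin.
Qed.

Lemma is_next_uniq r b b' : is_next r b -> is_next r b' -> b = b'.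
Proof.
move=> /is_nextP[bd rb bmin] /is_nextP[b'd rb' b'min].
apply: root_arrow_inj => //; apply/eqP; rewrite eqn_leq.
by rewrite bmin // b'min.
Qed.

Lemma next_rootE r b : is_next r b -> next_root r = Some b.
Proof.
rewrite /next_root; case: pickP => [b' H' H|-> //].
by congr Some; apply: is_next_uniq H' H.
Qed.

Variant next_root_spec r : option arr -> nat -> Prop :=
| NextSome b of is_next r b : next_root_spec r (Some b) (lo b)
| NextNone of {in root_arrows d, forall c, lo c <= start r} :
    next_root_spec r None n.*2.

Lemma next_rootP r : next_root_spec r (next_root r) (finish r).
Proof.
rewrite /finish /next_root; case: pickP => [b /NextSome //|none].
constructor => c cd; rewrite leqNgt; apply/negP => rc.
pose Q b := (b \in root_arrows d) && (start r < lo b).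
have Qc : Q c by rewrite /Q cd.
case: (arg_minnP (@lo n.+1) Qc) => b /andP[bd rb] bmin.
have := none b; suff -> : is_next r b by [].
apply/is_nextP.
by split=> // c' c'd rc'; apply: bmin; rewrite /Q c'd.
Qed.

Lemma next_root_none r : {in root_arrows d, forall c, lo c <= start r} ->
  next_root r = None.
Proof.
by move=> H; case: next_rootP => // b /is_nextP[bd]; rewrite ltnNge H.
Qed.

Lemma spine_regionP r : r \in regions d -> spine r ->
  if r is Some a then a \in root_arrows d else true.
Proof. by rewrite mem_regions; case: r => //= a ad ar; rewrite inE ad. Qed.

Lemma start_inj r r' : r \in regions d -> spine r -> r' \in regions d ->
  spine r' -> start r = start r' -> r = r'.
Proof.
move=> /spine_regionP rd /rd {}rd /spine_regionP r'd /r'd {}r'd.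
case: r r' rd r'd => [a|] [b|] //= rd r'd.
- by move=> ab; congr Some; apply: root_arrow_inj.
- by have [_ _ + _ _] := root_arrow_lo rd; case: (lo a).
- by have [_ _ + _ _] := root_arrow_lo r'd; case: (lo b).
Qed.

Lemma start_lt_finish r : 0 < n -> r \in regions d -> spine r ->
  start r < finish r <= n.*2.
Proof.
move=> n0 /spine_regionP rd /rd {}rd; case: next_rootP => [b /is_nextP[bd -> _]|_].
  by have [_ _ _ + _] := root_arrow_lo bd; move/ltnW->.
rewrite leqnn andbT; case: r rd => [a|_] /=; last by rewrite double_gt0.
by move=> /root_arrow_lo[].
Qed.

Lemma finish_le r b : b \in root_arrows d -> start r < lo b -> finish r <= lo b.
Proof.
move=> bd rb; case: next_rootP => [c /is_nextP[_ _ cmin]|H]; first exact: cmin.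
by have := H b bd; rewrite leqNgt rb.
Qed.

Lemma finish_lt r r' : 0 < n -> r \in regions d -> spine r ->
  r' \in regions d -> spine r' -> (finish r < finish r') = (start r < start r').
Proof.
move=> n0 rd rS r'd r'S.
have lt_fin r1 r2 : r1 \in regions d -> spine r1 -> r2 \in regions d ->
    spine r2 -> start r1 < start r2 -> finish r1 < finish r2.
  move=> r1d r1S r2d r2S r12; have /andP[+ _] := start_lt_finish n0 r2d r2S.
  apply: leq_ltn_trans; have := spine_regionP r2d r2S.
  by case: (r2) r12 => //= a ra aR; apply: finish_le.
have [rr'|r'r|rr'] := ltngtP (start r) (start r').
- exact: lt_fin.
- by apply/negbTE; rewrite -leqNgt ltnW // lt_fin.
- by rewrite (start_inj rd rS r'd r'S rr') ltnn.
Qed.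

(** In terms of [start] and [finish], no end of the spine is distinguished any
    more, so that this description is stable under reflection. *)
Lemma on_region_spine r k : r \in regions d -> spine r ->
  on_region d r k = (k == ord_max) ||
    (start r < spos k < finish r) &&
    [forall b in d, ~~ to_root b ==> ~~ covers b k].
Proof.
move=> rd rS; have rR := spine_regionP rd rS.
have [->|kn] /= := eqVneq k ord_max.
  apply/andP; split.
    case: r rR {rd rS} => //= a /root_arrow_lo[_ _ _ + ->].
    by rewrite /spos /=; move: (lo a); clear; lia.
  apply/forallP => b; apply/implyP => _; apply/implyP => _.
  by have := hi_le b; rewrite /spos /=; move: (hi b) (lo b); clear; lia.
have sk : spos k < n.*2.
  by have := ltn_ord k; move: kn; rewrite -(inj_eq val_inj) /= /spos;
    move: (k : nat); clear; lia.
have finish_spos : (start r < spos k < finish r) =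
    (start r < spos k) &&
    [forall b in root_arrows d, (start r < lo b) ==> (spos k < lo b)].
  congr (_ && _); apply/idP/forallP => [H b|H].
    apply/implyP => bd; apply/implyP => rb; apply: leq_trans H _.
    exact: finish_le.
  case: next_rootP => // b /is_nextP[bd rb _].
  exact: (implyP (implyP (H b) bd) rb).
rewrite finish_spos; apply/andP/andP => [[r_k H]|[/andP[r_k H1] H2]].
  have {}r_k : start r < spos k.
    case: r rR r_k {rd rS finish_spos H} => //= a /root_arrow_lo[_ ar _ _ _].
    rewrite to_root_lo // /spos; move: (a.1 : nat) (k : nat); clear; lia.
  split.
    rewrite r_k /=; apply/forallP => b; apply/implyP => bR; apply/implyP => rb.
    have [bd br b0 b1 hb] := root_arrow_lo bR.
    have := implyP (forallP H b) bd; have -> /= : beyondr r b.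
      case: (r) rb rR => [a|] //= ab /root_arrow_lo[_ _ _ _ ha].
      rewrite /beyond ha hb leqnn (ltnW ab) !andbT.
      by apply/eqP => ba; rewrite ba ltnn in ab.
    rewrite hb (to_root_lo br) /spos; move: sk; rewrite /spos.
    by move: (b.1 : nat) (k : nat); clear; lia.
  apply/forallP => c; apply/implyP => cd; apply/implyP => cr; apply/negP => ck.
  have := implyP (forallP H c) cd; rewrite -/(covers c k) ck implybF => /negP[].
  case: r rd rS rR r_k {finish_spos H} => //= a ad aS aR ak.
  have [{}ad ar a0 a1 ha] := root_arrow_lo aR.
  have := crossingN (dX ad cd); move: ck ak a0 a1; rewrite /beyond /covers ha.
  have -> : c != a by apply: contraNneq cr => ->.
  have [_ _] := mirror_nonroot cr.
  by move: (lo a) (lo c) (hi c) (spos k); clear; lia.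
have r_k' : (if r is Some a then lo a <= spos k <= hi a else true) = true.
  case: r rR r_k {rd rS finish_spos H1} => //= a /root_arrow_lo[_ _ _ _ ->] /ltnW->.
  by move: sk; move: (spos k); clear; lia.
split=> //; apply/forallP => b; apply/implyP => bd; apply/implyP => rb.
have [br|br] := boolP (to_root b); last first.
  exact: (implyP (implyP (forallP H2 b) bd) br).
have bR : b \in root_arrows d by rewrite inE bd.
have rb' : start r < lo b.
  case: r rd rS rR rb {r_k finish_spos H1 r_k'} => [a|] /=; last first.
    by have [_ _ + _ _] := root_arrow_lo bR.
  move=> _ _ aR /and3P[/eqP ba + _]; rewrite leq_eqVlt => /orP[/eqP ab|//].
  by case: ba; apply: root_arrow_inj.
have := implyP (implyP (forallP H1 b) bR) rb'.
by case: ltngtP.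
Qed.

(** As for [on_region_spine], this form of the condition is symmetric. *)
Lemma region_edge_spine r a : r \in regions d -> spine r -> a \in d ->
  ~~ to_root a ->
  region_edge d r (Some a) = [&& start r <= lo a, hi a <= finish r
    & [forall c in d, ~~ to_root c ==> ~~ beyond c a]].
Proof.
move=> rd rS ad ar; have rR := spine_regionP rd rS.
have [_ _ ha] := mirror_nonroot ar.
have la := lo_lt_hi a.
apply/andP/and3P => [[ra H]|[h1 h2 H]].
  split.
  - by case: (r) ra => //= e /and3P[].
  - case: next_rootP => // b /is_nextP[bR rb _].
    have [bd br b0 b1 hb] := root_arrow_lo bR.
    have := implyP (forallP H b) bd; have -> /= : beyondr r b.
      case: (r) rb rR => [e|] //= eb /root_arrow_lo[_ _ _ _ he].
      rewrite /beyond he hb leqnn (ltnW eb) !andbT.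
      by apply/eqP => be; rewrite be ltnn in eb.
    have := crossingN (dX bd ad); rewrite /beyond hb.
    have -> : a != b by apply: contraNneq ar => ->.
    by move: la ha; move: (lo a) (hi a) (lo b); clear; lia.
  - apply/forallP => c; apply/implyP => cd; apply/implyP => cr.
    apply/negP => ca; have := implyP (forallP H c) cd; rewrite ca andbT => /negP[].
    case: r rd rS rR ra {H} => //= e ed eS eR /and3P[_ ea _].
    have [{}ed er e0 e1 he] := root_arrow_lo eR.
    have [_ _ hc] := mirror_nonroot cr.
    have := crossingN (dX ed cd); case/and3P: ca => _ l h; move: l h ea hc la.
    rewrite /beyond he; have -> : c != e by apply: contraNneq cr => ->.
    by move: (lo a) (hi a) (lo e) (lo c) (hi c); clear; lia.
split.
  case: (r) rS rR h1 => //= e er eR ea; have [_ _ _ _ he] := root_arrow_lo eR.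
  rewrite /beyond ea he; apply/and3P; split=> //.
    by apply: contraNneq ar => ->.
  by move: ha; move: (hi a); clear; lia.
apply/forallP => c; apply/implyP => cd; apply/negP => /andP[rc ca].
have [cr|cr] := boolP (to_root c); last first.
  by have := implyP (implyP (forallP H c) cd) cr; rewrite ca.
have cR : c \in root_arrows d by rewrite inE cd.
have rc' : start r < lo c.
  case: r rd rS rR rc {h1 h2} => [e|] /=; last first.
    by have [_ _ + _ _] := root_arrow_lo cR.
  move=> _ _ eR /and3P[/eqP ce + _]; rewrite leq_eqVlt => /orP[/eqP ec|//].
  by case: ce; apply: root_arrow_inj.
have := finish_le cR rc'; case/and3P: ca => _ l _; move: l h2 la.
by move: (lo a) (hi a) (lo c) (finish r); clear; lia.
Qed.

End NextRoot.

Section MirrorRegion.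
Local Open Scope nat_scope.
Variables (n : nat) (d : {set arrow n.+1}).
Hypotheses (n0 : 0 < n) (dD : dissection d).
Notation arr := (arrow n.+1).
Implicit Types (a b c : arr) (r : option arr) (k : 'I_n.+1).

(** A region off the spine is entered through the same arrow in the mirror
    image. A spine region is entered there from the other end of the root side,
    hence through the arrow at which it finishes. *)
Definition mirror_region r : option arr :=
  omap (@mirror n) (if spine r then next_root d r else r).

Local Notation D := (@mirror n @: d).

Let DD : dissection D. Proof. by rewrite mirror_dissection. Qed.

Lemma mirror_root_arrows a : (mirror a \in root_arrows D) = (a \in root_arrows d).
Proof. by rewrite !inE mem_mirror mirror_to_root. Qed.

Lemma mirror_region_regions r : r \in regions d -> mirror_region r \in regions D.
Proof.
rewrite !mem_regions /mirror_region; case: ifP => rS; last first.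
  by case: r rS => //= a _; rewrite mem_mirror.
case: next_rootP => //= b /is_nextP[bR _ _] _; rewrite mem_mirror.
by case: (root_arrow_lo dD bR).
Qed.

Lemma mirror_region_spine r : spine (mirror_region r) = spine r.
Proof.
rewrite /mirror_region; case: ifP => [rS|]; last first.
  by case: r => //= a; rewrite mirror_to_root.
case: next_rootP => //= b /is_nextP[bR _ _]; rewrite mirror_to_root.
by case: (root_arrow_lo dD bR).
Qed.

Lemma start_mirror_region r :
  spine r -> start (mirror_region r) = n.*2 - finish d r.
Proof.
move=> rS; rewrite /mirror_region rS.
case: next_rootP => [b /is_nextP[bR _ _]|_] /=.
  by rewrite mirror_root //; case: (root_arrow_lo dD bR).
by rewrite subnn.
Qed.

Lemma next_root_mirror_region r : r \in regions d -> spine r ->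
  next_root D (mirror_region r) = omap (@mirror n) r.
Proof.
move=> rd rS; have rR := spine_regionP rd rS.
have st := start_mirror_region rS.
have lo_mirror c : c \in root_arrows D ->
    [/\ mirror c \in root_arrows d & lo c = n.*2 - lo (mirror c)].
  move=> cR; rewrite -mirror_root_arrows mirrorK cR; split=> //.
  rewrite -[in LHS](mirrorK c) mirror_root // mirror_to_root.
  by case: (root_arrow_lo DD cR).
case: r rd rS rR st => [a|] rd rS rR st /=.
  apply: (next_rootE DD); apply/is_nextP; split.
  - by rewrite mirror_root_arrows.
    have /andP[] := start_lt_finish dD n0 rd rS.
    by rewrite st mirror_root //=; move: (lo a) (finish d _); clear; lia.
  move=> c /lo_mirror[cR ->]; rewrite st (@mirror_root _ a) // => c_lt.
  apply: leq_sub2l; rewrite leqNgt; apply/negP => ac.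
  have := finish_le (r := Some a) cR ac; move: c_lt; move: (finish _ _) (lo _).
  by clear; lia.
apply: next_root_none => c /lo_mirror[cR ->]; rewrite st.
apply: leq_sub2l; apply: finish_le => //=.
by case: (root_arrow_lo dD cR).
Qed.

Lemma finish_mirror_region r : r \in regions d -> spine r ->
  finish D (mirror_region r) = n.*2 - start r.
Proof.
move=> rd rS; rewrite /finish next_root_mirror_region //.
have := spine_regionP rd rS; case: r rd rS => [a|] rd rS /=; last by rewrite subn0.
by move=> aR; rewrite mirror_root.
Qed.

Lemma on_region_mirror_region r k : r \in regions d ->
  on_region D (mirror_region r) (mirror_side k) = on_region d r k.
Proof.
have covers_mirror c :
    ~~ to_root c -> covers (mirror c) (mirror_side k) = covers c k.
  move=> cr; rewrite /covers; have [-> -> hc] := mirror_nonroot cr.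
  have lc := lo_lt_hi c.
  have [->|kn] := eqVneq k ord_max.
    have -> : mirror_side ord_max = ord_max :> 'I_n.+1.
      by apply/eqP; rewrite mirror_side_max.
    by rewrite /spos /=; move: lc hc; move: (lo c) (hi c); clear; lia.
  have [-> sk] := mirror_spos kn; move: lc hc sk.
  by move: (lo c) (hi c) (spos k); clear; lia.
move=> rd; have [rS|rS] := boolP (spine r).
  rewrite !on_region_spine ?mirror_region_regions ?mirror_region_spine //.
  rewrite mirror_side_max; case: (eqVneq k ord_max) => //= kn.
  have /andP[sf fn] := start_lt_finish dD n0 rd rS.
  rewrite start_mirror_region // finish_mirror_region //.
  have [-> sk] := mirror_spos kn.
  rewrite forall_mirror; congr (_ && _).
    by move: sf fn sk; move: (start r) (finish d r) (spos k); clear; lia.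
  apply: eq_forallb => b; rewrite mirror_to_root; congr (_ ==> _).
  by case: (boolP (to_root b)) => //= br; rewrite covers_mirror.
case: r rS rd => //= a ar ad; rewrite /mirror_region /= (negPf ar) /on_region /=.
rewrite forall_mirror; have [-> -> ha] := mirror_nonroot ar.
have la := lo_lt_hi a.
congr (_ && _).
  have [->|kn] := eqVneq k ord_max.
    have -> : mirror_side ord_max = ord_max :> 'I_n.+1.
      by apply/eqP; rewrite mirror_side_max.
    by rewrite /spos /=; move: la ha; move: (lo a) (hi a); clear; lia.
  have [-> sk] := mirror_spos kn; move: la ha sk.
  by move: (lo a) (hi a) (spos k); clear; lia.
apply: eq_forallb => b; rewrite mirror_beyond //; congr (_ ==> _).
case: (boolP (beyond a b)) => //= /and3P[_ _ hb]; congr (~~ _).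
apply: covers_mirror; rewrite to_root_hi.
by move: hb ha; move: (hi a) (hi b); clear; lia.
Qed.

Lemma rib_mirror_region r r' : r \in regions d -> r' \in regions d ->
  rib D (mirror_region r) (mirror_region r') = rib d r r'.
Proof.
move=> rd; rewrite /rib mirror_region_spine.
case: r' => [a|] ad; last by rewrite !andbF.
case: (boolP (spine (Some a))) => ar; first by rewrite !andbF.
rewrite !andbT; have -> : mirror_region (Some a) = Some (mirror a).
  by rewrite /mirror_region (negPf ar).
rewrite mem_regions in ad; have [rS|rS] := boolP (spine r).
  have [la ha hn] := mirror_nonroot ar.
  rewrite !region_edge_spine ?mirror_region_regions ?mirror_region_spine
    ?mem_mirror ?mirror_to_root //.
  rewrite start_mirror_region // finish_mirror_region // la ha.
  have /andP[sf fn] := start_lt_finish dD n0 rd rS; have lha := lo_lt_hi a.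
  rewrite forall_mirror !andbA; congr (_ && _).
    by move: sf fn lha hn; move: (lo a) (hi a) (start r) (finish d r); clear; lia.
  apply: eq_forallb => c; rewrite mirror_to_root; congr (_ ==> _).
  by case: (boolP (to_root c)) => //= cr; rewrite mirror_beyond.
case: r rS rd => //= b br bd; rewrite /mirror_region /= (negPf br) /region_edge /=.
rewrite mirror_beyond // forall_mirror; congr (_ && _).
apply: eq_forallb => c; rewrite mirror_beyond //; congr (_ ==> ~~ _).
case: (boolP (beyond b c)) => //= /and3P[_ _ hc].
have [_ _ hb] := mirror_nonroot br.
apply: mirror_beyond; rewrite to_root_hi.
by move: hb hc; move: (hi b) (hi c); clear; lia.
Qed.

Lemma folded_mirror_region r r' : r \in regions d -> r' \in regions d ->
  folded D n.*2.+1 (mirror_region r) (mirror_region r') = folded d 0 r r'.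
Proof.
move=> rd r'd; rewrite /folded rib_mirror_region //; congr (_ || _).
rewrite /bent !mirror_region_spine.
case: (boolP (spine r)) => //= rS; case: (boolP (spine r')) => //= r'S.
have /andP[_ fn] := start_lt_finish dD n0 rd rS.
have /andP[_ fn'] := start_lt_finish dD n0 r'd r'S.
rewrite !start_mirror_region // -(finish_lt dD n0 r'd r'S rd rS); move: fn fn'.
by move: (finish d r) (finish d r') (start r) (start r'); clear; lia.
Qed.

End MirrorRegion.

Section MirrorRegionInvolution.
Variables (n : nat) (d : {set arrow n.+1}).
Hypotheses (n0 : (0 < n)%N) (dD : dissection d).

Lemma mirror_regionK r : r \in regions d ->
  mirror_region (@mirror n @: d) (mirror_region d r) = r.
Proof.
move=> rd; rewrite {1}/mirror_region mirror_region_spine //; case: ifP => rS.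
  by rewrite next_root_mirror_region //; case: (r) => //= a; rewrite mirrorK.
by rewrite /mirror_region rS; case: (r) => //= a; rewrite mirrorK.
Qed.

End MirrorRegionInvolution.

Lemma mirror_region_imset n (d : {set arrow n.+1}) : (0 < n)%N -> dissection d ->
  regions (@mirror n @: d) = mirror_region d @: regions d.
Proof.
move=> n0 dD; apply/setP => r; apply/idP/imsetP => [rD|[r' r'd ->]].
  exists (mirror_region (@mirror n @: d) r).
    rewrite -[X in regions X](imset_mirrorK d).
    by rewrite mirror_region_regions ?mirror_dissection.
  rewrite -[X in mirror_region X](imset_mirrorK d).
  by rewrite mirror_regionK // mirror_dissection.
exact: mirror_region_regions.
Qed.

Lemma map_mirror_enum n :
  map (@mirror_side n) (enum 'I_n.+1) = rot 1 (rev (enum 'I_n.+1)).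
Proof.
apply: (inj_map val_inj); rewrite map_rot map_rev -map_comp val_enum_ord.
have -> : iota 0 n.+1 = rcons (iota 0 n) n by rewrite -[n.+1]addn1 iotaD cats1.
rewrite rev_rcons rot1_cons; apply: (@eq_from_nth _ 0%N).
  by rewrite size_map size_enum_ord size_rcons size_rev size_iota.
move=> i; rewrite size_map size_enum_ord => iN.
rewrite (nth_map ord0) ?size_enum_ord //= val_mirror_side nth_enum_ord //.
rewrite nth_rcons size_rev size_iota; case: ltngtP => [i_n|n_i|_].
- by rewrite nth_rev size_iota // nth_iota; lia.
- by lia.
- by [].
Qed.

Lemma trace_mirror_region n (d : {set arrow n.+1}) r : (0 < n)%N -> dissection d ->
  r \in regions d ->
  map (@mirror_side n) (trace (@mirror n @: d) (mirror_region d r)) =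
  if spine r then rot 1 (rev (trace d r)) else rev (trace d r).
Proof.
move=> n0 dD rd; rewrite /trace.
have -> : [seq k <- enum 'I_n.+1
           | on_region (@mirror n @: d) (mirror_region d r) k] =
    map (@mirror_side n)
      [seq k <- rot 1 (rev (enum 'I_n.+1)) | on_region d r k].
  rewrite -map_mirror_enum filter_map -map_comp.
  rewrite (eq_map (@mirror_sideK n)) map_id; apply: eq_filter => k /=.
  by rewrite -[in LHS](mirror_sideK k) on_region_mirror_region.
rewrite -map_comp (eq_map (@mirror_sideK n)) map_id.
rewrite enum_ordSr rev_rcons rot1_cons !filter_rcons filter_rev.
have := on_region_root_side d r; case: (boolP (spine r)) => rS on.
  have nS : on_region d r ord_max.
    suff <- : root_side r = ord_max by [].
    by case: (r) rS => //= a /eqP an; apply: val_inj.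
  by rewrite nS rev_rcons rot1_cons.
have /negPf nS : ~~ on_region d r ord_max.
  case: r rS {on rd} => //= a ar; rewrite /on_region.
  have [_ _ ha] := mirror_nonroot ar; rewrite /spos /=.
  by move: ha; move: (hi a) (lo a); clear; lia.
by rewrite nS.
Qed.

Lemma eq_reindex_sum (V : nmodType) (I : finType) (h : I -> I) (P : pred I)
    (F G : I -> V) : injective h -> (forall i, P (h i) = P i) ->
  (forall i, P i -> F (h i) = G i) -> \sum_(i | P i) F i = \sum_(i | P i) G i.
Proof.
move=> h_inj Ph FG; rewrite (reindex_inj h_inj); apply: eq_big => // i.
by rewrite Ph; apply: FG.
Qed.

Section ReflectedSum.
Variables (R : choiceType) (P0 : polygon R) (n : nat) (x : 'I_n.+1 -> R).
Hypothesis n0 : (0 < n)%N.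
Implicit Types (d : {set arrow n.+1}).

(** The labels that go with [folded d m]: the part of the spine that is turned
    round comes from a reflected polygon. *)
Definition turned (m : nat) d (r : option (arrow n.+1)) : polygon R :=
  if spine r && (m <= start r)%N then tau (lab P0 x d r) else lab P0 x d r.

Definition sgn_fwd d : rat :=
  \prod_(a in d | forwards a && ~~ to_root a) (-1) ^+ wt d (Some a).

Lemma wt_mirror_region d r : dissection d -> r \in regions d ->
  wt (@mirror n @: d) (mirror_region d r) = wt d r.
Proof.
move=> dD rd; rewrite /wt -(size_map (@mirror_side n)) trace_mirror_region //.
by case: ifP; rewrite ?size_rot size_rev.
Qed.

Lemma reversed_spine (r : option (arrow n.+1)) : spine r -> reversed r = false.
Proof.
case: r => //= a; rewrite /to_root /backwards => /eqP->.
by rewrite ltnNge -ltnS ltn_ord.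
Qed.

Lemma reversed_mirror (a : arrow n.+1) : nontrivial a -> ~~ to_root a ->
  backwards (mirror a) = forwards a.
Proof.
rewrite nontrivialE /to_root /backwards /forwards /= val_mirror_side.
move=> /and3P[h1 h2 _] h3; rewrite (negPf h3); move: h1 h2 h3.
have := ltn_ord a.1; have := ltn_ord a.2.
by move: (a.1 : nat) (a.2 : nat); clear; lia.
Qed.

(** Off the spine, the mirror image reverses the list of sides and exchanges
    forwards and backwards arrows, hence whether the list is read backwards; the
    two effects cancel. *)
Lemma lab_mirror_region d r : dissection d -> r \in regions d ->
  lab P0 (x \o @mirror_side n) (@mirror n @: d) (mirror_region d r) = turned 0 d r.
Proof.
move=> dD rd; have n1 : (1 < n.+1)%N by [].
have DD : dissection (@mirror n @: d) by rewrite mirror_dissection.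
have tD := mirror_region_regions dD rd.
have tr := trace_mirror_region n0 dD rd.
rewrite /turned andbT.
case: (boolP (spine r)) tr => rS tr; apply: val_inj; rewrite /= !sides_lab //.
  rewrite !reversed_spine ?mirror_region_spine // map_comp tr.
  by rewrite map_rot map_rev.
case: r rS rd tD tr => // a ar ad tD tr.
have tE : mirror_region d (Some a) = Some (mirror a).
  by rewrite /mirror_region (negPf ar).
rewrite mem_regions in ad.
have aN : nontrivial a by case: (elimT (dissectionP d) dD) => dN _; exact: dN.
have -> : reversed (mirror_region d (Some a)) = ~~ reversed (Some a).
  rewrite tE /= reversed_mirror // /forwards /backwards.
  have [+ _ _] := nontrivial_neq aN; move: (a.1 : nat) (a.2 : nat); clear; lia.
rewrite map_comp; case: ifP => /= [/negPf->|/negbFE->].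
  by rewrite map_rev tr revK.
by rewrite tr.
Qed.

Lemma sgn_mirror d : dissection d -> sgn (@mirror n @: d) = sgn_fwd d.
Proof.
move=> dD; have [dN _] := elimT (dissectionP d) dD.
rewrite /sgn /sgn_fwd big_imset_cond /=; last by move=> a b _ _; apply: mirror_inj.
apply: eq_big => [a|a /andP[ad ba]].
  case ad: (a \in d) => //=; have [ar|ar] := boolP (to_root a).
    rewrite andbF; apply: (@reversed_spine (Some (mirror a))).
    by rewrite /= mirror_to_root.
  by rewrite andbT reversed_mirror ?dN.
have ar : ~~ to_root a.
  apply: contraL ba => ar; rewrite -[backwards _]/(reversed (Some (mirror a))).
  by rewrite reversed_spine //= mirror_to_root.
rewrite -(@wt_mirror_region d (Some a)) ?mem_regions //.
by rewrite /mirror_region /= (negPf ar).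
Qed.

Lemma Lambda_sides_mirror : Lambda_sides P0 (x \o @mirror_side n) =
  \sum_(d : {set arrow n.+1} | dissection d)
    sgn_fwd d *: Lambda (Forest (regions d) (folded d 0) (turned 0 d)).
Proof.
apply: (eq_reindex_sum (imset_inj (@mirror_inj n))) => [d|d dD].
  exact: mirror_dissection.
rewrite (sgn_mirror dD).
apply: congr1; apply: (Lambda_iso (f := mirror_region d)).
- move=> r r' rd r'd rr'; rewrite -(mirror_regionK n0 dD rd).
  by rewrite -(mirror_regionK n0 dD r'd) rr'.
- exact: mirror_region_imset.
- by move=> r r' rd r'd; apply: folded_mirror_region.
- by move=> r rd; apply: lab_mirror_region.
Qed.

Lemma sides_tau_map (P : polygon R) : sides P = map x (enum 'I_n.+1) ->
  sides (tau P) = map (x \o @mirror_side n) (enum 'I_n.+1).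
Proof.
by move=> Px; rewrite map_comp map_mirror_enum map_rot map_rev -Px.
Qed.

End ReflectedSum.

Lemma filter_embed N M (f : 'I_M -> 'I_N) (P : pred 'I_N) (Q : pred 'I_M) :
  {homo f : i j / (i < j)%N} -> (forall i, P (f i) = Q i) ->
  (forall k, P k -> exists i, k = f i) ->
  [seq k <- enum 'I_N | P k] = [seq f i | i <- enum 'I_M & Q i].
Proof.
move=> f_mono PQ Pf; apply: (inj_map val_inj).
have srt (s : seq nat) (p : pred nat) : sorted ltn s -> sorted ltn (filter p s).
  exact: sorted_filter ltn_trans _ _.
have enum_sorted m : sorted (relpre val ltn) (enum 'I_m).
  by rewrite -sorted_map val_enum_ord iota_ltn_sorted.
apply: (irr_sorted_eq ltn_trans ltnn).
- by rewrite sorted_map; apply: sorted_filter => // ? ? ?; exact: ltn_trans.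
- rewrite -map_comp sorted_map.
  have: sorted (relpre val ltn) [seq i <- enum 'I_M | Q i].
    by apply: sorted_filter => // ? ? ?; exact: ltn_trans.
  by apply: sub_sorted => i j; apply: f_mono.
move=> u; apply/mapP/mapP => -[k].
  rewrite mem_filter => /andP[Pk _] ->; have [i ki] := Pf k Pk.
  exists k => //; rewrite ki map_f // mem_filter -PQ -ki Pk mem_enum //.
case/mapP=> i; rewrite mem_filter => /andP[Qi _] -> ->.
by exists (f i); rewrite // mem_filter PQ Qi mem_enum.
Qed.

(** * Gluing dissections along an arrow to the root side *)
Section Glue.
Local Open Scope nat_scope.
Variables (p q : nat).
Hypotheses (p0 : 0 < p) (q0 : 0 < q).
Notation n := (p + q).

(** The arrow [cut] from vertex [p] to the root side of a polygon with
    [p + q + 1] sides has a root polygon made of the sides [0, ..., p - 1] and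
    the root side, and a cut-off polygon made of the sides [p, ..., p + q]. The
    suffixes [L] and [R] refer to these two polygons. *)
Definition sideL (k : 'I_p.+1) : 'I_n.+1 := inord (if k == p :> nat then n else k).
Definition sideR (k : 'I_q.+1) : 'I_n.+1 := inord (p + k).
Definition emL (a : arrow p.+1) : arrow n.+1 := (inord a.1, sideL a.2).
Definition emR (a : arrow q.+1) : arrow n.+1 := (inord (p + a.1), sideR a.2).
Definition cut : arrow n.+1 := (inord p, ord_max).

Lemma val_sideL k : sideL k = (if k == p :> nat then n else k) :> nat.
Proof.
rewrite /sideL inordK //; have := ltn_ord k; move: (k : nat) => u.
by clear; case: ifP; lia.
Qed.

Lemma val_sideR k : sideR k = p + k :> nat.
Proof. by rewrite /sideR inordK // ltnS leq_add2l -ltnS ltn_ord. Qed.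

Lemma val_emL1 a : (emL a).1 = a.1 :> nat.
Proof.
by rewrite inordK //; have := ltn_ord a.1; move: (a.1 : nat); clear; lia.
Qed.

Lemma val_emR1 a : (emR a).1 = p + a.1 :> nat.
Proof. by rewrite inordK // ltnS leq_add2l -ltnS ltn_ord. Qed.

Lemma sideL_inj : injective sideL.
Proof.
move=> k k' /(congr1 (@nat_of_ord _)); rewrite !val_sideL => kk'.
apply: val_inj => /=; have := ltn_ord k; have := ltn_ord k'; move: q0 kk'.
by move: (k : nat) (k' : nat) => u v; clear; do 2!case: ifP; lia.
Qed.

Lemma sideR_inj : injective sideR.
Proof.
move=> k k' /(congr1 (@nat_of_ord _)); rewrite !val_sideR => /addnI kk'.
exact: val_inj.
Qed.

Lemma emL_inj : injective emL.
Proof.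
move=> [i j] [i' j'] ab; have := congr1 (fun a => nat_of_ord a.1) ab.
rewrite !val_emL1 /= => /val_inj->; congr (_, _).
by move: ab => [_ /sideL_inj].
Qed.

Lemma emR_inj : injective emR.
Proof.
move=> [i j] [i' j'] ab; have := congr1 (fun a => nat_of_ord a.1) ab.
rewrite !val_emR1 /= => /addnI/val_inj->; congr (_, _).
by move: ab => [_ /sideR_inj].
Qed.

Lemma emL_root a : to_root (emL a) = to_root a.
Proof.
rewrite /to_root val_sideL; have := ltn_ord a.2; move: q0.
by move: (a.2 : nat); clear => u; case: ifP; lia.
Qed.

Lemma emR_root a : to_root (emR a) = to_root a.
Proof. by rewrite /to_root val_sideR eqn_add2l. Qed.

Lemma cut_lo_hi : lo cut = p.*2 /\ hi cut = n.*2.+1.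
Proof.
rewrite /lo /hi /spos /cut /= inordK; first by clear; lia.
by rewrite ltnS leq_addr.
Qed.

Lemma cut_root : to_root cut. Proof. by rewrite /to_root /=. Qed.

Lemma cut_nontrivial : nontrivial cut.
Proof.
rewrite nontrivialE /= inordK; last by rewrite ltnS leq_addr.
by move: p0 q0; clear; lia.
Qed.

Lemma emL_lo a : lo (emL a) = lo a.
Proof.
rewrite /lo /spos val_emL1 val_sideL; have := ltn_ord a.1; have := ltn_ord a.2.
move: q0; move: (a.1 : nat) (a.2 : nat); clear => u v; case: ifP; lia.
Qed.

Lemma emL_hi a : hi (emL a) = if to_root a then n.*2.+1 else hi a.
Proof.
rewrite /hi /spos val_emL1 val_sideL /to_root; have := ltn_ord a.1.
have := ltn_ord a.2.
move: q0; move: (a.1 : nat) (a.2 : nat); clear => u v; case: ifP; lia.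
Qed.

Lemma emR_lo a : lo (emR a) = p.*2 + lo a.
Proof.
rewrite /lo /spos val_emR1 val_sideR.
by move: (a.1 : nat) (a.2 : nat); clear => u v; lia.
Qed.

Lemma emR_hi a : hi (emR a) = p.*2 + hi a.
Proof.
rewrite /hi /spos val_emR1 val_sideR.
by move: (a.1 : nat) (a.2 : nat); clear => u v; lia.
Qed.

Lemma emL_bounds (a : arrow p.+1) : [/\ lo a < hi a, hi a <= p.*2.+1, lo a <= p.*2
  & to_root a = (hi a == p.*2.+1)].
Proof.
split; [exact: lo_lt_hi|exact: hi_le| |exact: to_root_hi].
by have := lo_lt_hi a; have := hi_le a; move: (lo a) (hi a); clear; lia.
Qed.

Lemma emL_nontrivial a : nontrivial a = nontrivial (emL a) && (emL a != cut).
Proof.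
rewrite !nontrivialE val_emL1 val_sideL.
have -> : (emL a == cut) = (a.1 == p :> nat) && (a.2 == p :> nat).
  rewrite -pair_eqE /pair_eq -!(inj_eq val_inj) /= val_emL1 val_sideL.
  rewrite inordK; last by rewrite ltnS leq_addr.
  have := ltn_ord a.2; move: (a.1 : nat) (a.2 : nat) q0; clear => u v.
  by case: ifP; lia.
have := ltn_ord a.1; have := ltn_ord a.2; move: p0 q0.
by move: (a.1 : nat) (a.2 : nat); clear => u v; case: ifP; lia.
Qed.

Lemma emR_nontrivial a : nontrivial a = nontrivial (emR a) && (emR a != cut).
Proof.
rewrite !nontrivialE val_emR1 val_sideR.
have -> : (emR a == cut) = (a.1 == 0 :> nat) && (a.2 == q :> nat).
  rewrite -pair_eqE /pair_eq -!(inj_eq val_inj) /= val_emR1 val_sideR.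
  rewrite inordK; last by rewrite ltnS leq_addr.
  by move: (a.1 : nat) (a.2 : nat); clear; lia.
have := ltn_ord a.1; have := ltn_ord a.2; move: p0 q0.
by move: (a.1 : nat) (a.2 : nat); clear => u v; lia.
Qed.

(** Among the arrows of a glued dissection, this inequality separates those of
    the root polygon from [cut] and those of the cut-off polygon. *)
Lemma emL_lo_lt a : nontrivial a -> lo (emL a) < p.*2.
Proof.
rewrite emL_lo; have [l h lp ar] := emL_bounds a.
have [aR|] := boolP (to_root a).
  move=> aN; have [-> _] := to_rootE aR; have := nontrivial_root aN aR.
  by move: (a.1 : nat); clear; lia.
by rewrite ar; move: l h lp; move: (lo a) (hi a); clear; lia.
Qed.

Lemma crossing_sym N (a b : arrow N) : crossing a b = crossing b a.
Proof. by rewrite /crossing orbC. Qed.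

Lemma emL_crossing a b : crossing (emL a) (emL b) = crossing a b.
Proof.
rewrite /crossing !emL_lo !emL_hi.
have [la ha lpa ->] := emL_bounds a; have [lb hb lpb ->] := emL_bounds b.
move: la ha lpa lb hb lpb; move: (lo a) (lo b) (hi a) (hi b).
by clear -q0 => l1 l2 h1 h2; do 2!case: ifP; lia.
Qed.

Lemma emR_crossing a b : crossing (emR a) (emR b) = crossing a b.
Proof.
rewrite /crossing !emR_lo !emR_hi.
by move: (lo a) (lo b) (hi a) (hi b); clear; lia.
Qed.

Lemma emLR_crossing a b : crossing (emL a) (emR b) = false.
Proof.
rewrite /crossing !emL_lo !emL_hi !emR_lo !emR_hi.
have [la ha lpa ->] := emL_bounds a; have := hi_le b.
move: la ha lpa; move: (lo a) (lo b) (hi a) (hi b).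
by clear => l1 l2 h1 h2; case: ifP; lia.
Qed.

Lemma emL_cut_crossing a : crossing (emL a) cut = false.
Proof.
rewrite /crossing !emL_lo !emL_hi; have [-> ->] := cut_lo_hi.
have [la ha lpa ->] := emL_bounds a.
move: la ha lpa; move: (lo a) (hi a).
by clear => l1 h1; case: ifP; lia.
Qed.

Lemma emR_cut_crossing a : crossing (emR a) cut = false.
Proof.
rewrite /crossing !emR_lo !emR_hi; have [-> ->] := cut_lo_hi.
have := hi_le a; move: (lo a) (hi a); clear; lia.
Qed.

Definition glue (dl : {set arrow p.+1}) (dr : {set arrow q.+1}) :
    {set arrow n.+1} := cut |: (emL @: dl :|: emR @: dr).

(** The trivial arrow from vertex [p] to the root side of the root polygon is
    mapped to [cut] itself, and has to be left out; likewise for [partR]. *)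
Definition partL (d : {set arrow n.+1}) : {set arrow p.+1} :=
  [set a | (emL a \in d) && (emL a != cut)].
Definition partR (d : {set arrow n.+1}) : {set arrow q.+1} :=
  [set a | (emR a \in d) && (emR a != cut)].

Implicit Types (dl : {set arrow p.+1}) (dr : {set arrow q.+1}).

Lemma cut_glue dl dr : cut \in glue dl dr.
Proof. by rewrite !inE eqxx. Qed.

Lemma mem_glue dl dr c : reflect
  [\/ c = cut, exists2 a, a \in dl & c = emL a | exists2 a, a \in dr & c = emR a]
  (c \in glue dl dr).
Proof.
rewrite !inE; apply: (iffP or3P) => -[].
- by move/eqP=> ->; constructor 1.
- by case/imsetP=> a ad ->; constructor 2; exists a.
- by case/imsetP=> a ad ->; constructor 3; exists a.
- by move=> ->; constructor 1.
- by case=> a ad ->; constructor 2; apply: imset_f.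
- by case=> a ad ->; constructor 3; apply: imset_f.
Qed.

Lemma forall_glue dl dr (P : pred (arrow n.+1)) :
  [forall c in glue dl dr, P c] =
  [&& P cut, [forall a in dl, P (emL a)] & [forall a in dr, P (emR a)]].
Proof.
apply/forallP/and3P => [H|[Hc /forallP H1 /forallP H2] c].
  split; first by apply: (implyP (H _)); apply: cut_glue.
    apply/forallP => a; apply/implyP => ad; apply: (implyP (H _)).
    by apply/mem_glue; constructor 2; exists a.
  apply/forallP => a; apply/implyP => ad; apply: (implyP (H _)).
  by apply/mem_glue; constructor 3; exists a.
apply/implyP => /mem_glue[->|[a ad ->]|[a ad ->]] //.
  exact: (implyP (H1 a)).
exact: (implyP (H2 a)).
Qed.

Lemma glue_dissection dl dr :
  dissection dl -> dissection dr -> dissection (glue dl dr).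
Proof.
move=> /dissectionP[dN1 dX1] /dissectionP[dN2 dX2]; apply/dissectionP; split.
  move=> c /mem_glue[->|[a ad ->]|[a ad ->]]; first exact: cut_nontrivial.
    by have := dN1 a ad; rewrite emL_nontrivial => /andP[].
  by have := dN2 a ad; rewrite emR_nontrivial => /andP[].
have cut_cut : crossing cut cut = false by rewrite /crossing !ltnn.
move=> c c' /mem_glue[->|[a ad ->]|[a ad ->]] /mem_glue[->|[b bd ->]|[b bd ->]].
- by rewrite cut_cut.
- by rewrite crossing_sym emL_cut_crossing.
- by rewrite crossing_sym emR_cut_crossing.
- by rewrite emL_cut_crossing.
- by rewrite emL_crossing dX1.
- by rewrite emLR_crossing.
- by rewrite emR_cut_crossing.
- by rewrite crossing_sym emLR_crossing.
- by rewrite emR_crossing dX2.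
Qed.

Lemma partL_dissection d : dissection d -> dissection (partL d).
Proof.
move=> /dissectionP[dN dX]; apply/dissectionP; split=> [a|a b]; rewrite !inE.
  by case/andP=> ad ac; rewrite emL_nontrivial dN.
by case/andP=> ad _ /andP[bd _]; rewrite -emL_crossing dX.
Qed.

Lemma partR_dissection d : dissection d -> dissection (partR d).
Proof.
move=> /dissectionP[dN dX]; apply/dissectionP; split=> [a|a b]; rewrite !inE.
  by case/andP=> ad ac; rewrite emR_nontrivial dN.
by case/andP=> ad _ /andP[bd _]; rewrite -emR_crossing dX.
Qed.

Lemma emL_neq_emR a b : nontrivial a -> emL a != emR b.
Proof.
move=> /emL_lo_lt; apply: contraTneq => ->.
by rewrite emR_lo -leqNgt leq_addr.
Qed.

Lemma partL_glue dl dr : dissection dl -> dissection dr -> partL (glue dl dr) = dl.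
Proof.
move=> /dissectionP[dN1 _] /dissectionP[dN2 _]; apply/setP => a; rewrite inE.
apply/andP/idP => [[/mem_glue[->|[b bd /emL_inj->]|[b bd ab]] ac]|ad] //.
- by rewrite eqxx in ac.
- have aN : nontrivial a.
    rewrite emL_nontrivial ac andbT ab.
    by have := dN2 b bd; rewrite emR_nontrivial => /andP[].
  by have := emL_neq_emR b aN; rewrite ab eqxx.
split; first by apply/mem_glue; constructor 2; exists a.
by have := dN1 a ad; rewrite emL_nontrivial => /andP[].
Qed.

Lemma partR_glue dl dr : dissection dl -> dissection dr -> partR (glue dl dr) = dr.
Proof.
move=> /dissectionP[dN1 _] /dissectionP[dN2 _]; apply/setP => a; rewrite inE.
apply/andP/idP => [[/mem_glue[->|[b bd ab]|[b bd /emR_inj->]] ac]|ad] //.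
- by rewrite eqxx in ac.
- by have := emL_neq_emR a (dN1 b bd); rewrite ab eqxx.
split; first by apply/mem_glue; constructor 3; exists a.
by have := dN2 a ad; rewrite emR_nontrivial => /andP[].
Qed.

Lemma emL_surj b : (hi b <= p.*2) || to_root b && (lo b <= p.*2) ->
  exists a, b = emL a.
Proof.
move=> H; exists (inord b.1, inord (if to_root b then p else b.2)).
have h1 : b.1 < p.+1.
  case/orP: H => [|/andP[br]]; last by rewrite to_root_lo // leq_double.
  by rewrite geq_max leq_double => /andP[].
have h2 : (if to_root b then p else b.2) < p.+1.
  case: ifP H => //= _; rewrite orbF geq_max /spos.
  by move: (b.1 : nat) (b.2 : nat); clear; lia.
have h3 : b.2 != p :> nat \/ to_root b.
  case/orP: H => [|/andP[]]; last by right.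
  rewrite geq_max /spos => /andP[_ h]; left; move: h.
  by move: (b.2 : nat); clear; lia.
case: b H h1 h2 h3 => i j H h1 h2 h3; congr (_, _); apply: val_inj => /=.
  by rewrite !inordK //; move: (ltn_ord i).
rewrite val_sideL /= inordK //; move: h3; rewrite /to_root /=.
by case: (eqVneq (j : nat) n) => [->|_] h; rewrite ?eqxx //; case: h => [/negPf->|].
Qed.

Lemma emR_surj b : p.*2 <= lo b -> exists a, b = emR a.
Proof.
rewrite leq_min /spos => /andP[h1 h2].
have b1 := ltn_ord b.1; have b2 := ltn_ord b.2.
exists (inord (b.1 - p), inord (b.2 - p)).
have h3 : b.1 - p < q.+1 by move: b1; move: (b.1 : nat); clear; lia.
have h4 : b.2 - p < q.+1 by move: b2; move: (b.2 : nat); clear; lia.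
case: b h1 h2 h3 h4 {b1 b2} => i j /= h1 h2 h3 h4.
have hi : p + (i - p) = i by move: h1; move: (i : nat); clear; lia.
have hj : p + (j - p) = j by move: h2; move: (j : nat); clear; lia.
congr (_, _); apply: val_inj => /=.
  by rewrite !inordK // hi.
by rewrite val_sideR /= inordK.
Qed.

Lemma glue_parts d : dissection d -> cut \in d -> glue (partL d) (partR d) = d.
Proof.
move=> /dissectionP[dN dX] cd; apply/setP => b; apply/mem_glue/idP.
  by case=> [->|[a]|[a]] //; rewrite inE => /andP[ad _] ->.
move=> bd; have [->|bc] := eqVneq b cut; first by constructor 1.
have := crossingN (negbTE (dX cut b cd bd)); have [lc hc] := cut_lo_hi.
have lb := lo_lt_hi b; have hb := hi_le b; rewrite lc hc => H.
have [bR|bL] := leqP p.*2 (lo b).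
  have [a ab] := emR_surj bR; constructor 3; exists a => //.
  by rewrite inE -ab bd.
have [|a ab] := @emL_surj b; last first.
  by constructor 2; exists a; rewrite // inE -ab bd.
rewrite to_root_hi; move: lb hb bL H.
by move: (lo b) (hi b); clear; lia.
Qed.

Definition regL (r : option (arrow p.+1)) : option (arrow n.+1) := omap emL r.
(** The root region of the cut-off polygon is the region entered through
    [cut]. *)
Definition regR (r : option (arrow q.+1)) : option (arrow n.+1) :=
  Some (if r is Some a then emR a else cut).

Lemma regL_inj : injective regL.
Proof. by move=> [a|] [b|] //= /Some_inj/emL_inj->. Qed.

Lemma spine_regL r : spine (regL r) = spine r.
Proof. by case: r => //= a; rewrite emL_root. Qed.

Lemma spine_regR r : spine (regR r) = spine r.
Proof. by case: r => [a|] /=; rewrite ?emR_root ?cut_root. Qed.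

Lemma start_regL r : start (regL r) = start r.
Proof. by case: r => //= a; rewrite emL_lo. Qed.

Lemma start_regR r : start (regR r) = p.*2 + start r.
Proof.
case: r => [a|] /=; first by rewrite emR_lo.
by have [-> _] := cut_lo_hi; rewrite addn0.
Qed.

Lemma beyond_emL a b : beyond (emL a) (emL b) = beyond a b.
Proof.
rewrite /beyond (inj_eq emL_inj) !emL_lo !emL_hi; congr (_ && (_ && _)).
have [la ha lpa ->] := emL_bounds a; have [lb hb lpb ->] := emL_bounds b.
move: la ha lpa lb hb lpb; move: (lo a) (lo b) (hi a) (hi b).
by clear -q0 => l1 l2 h1 h2; do 2!case: ifP; lia.
Qed.

Lemma beyond_emR a b : beyond (emR a) (emR b) = beyond a b.
Proof. by rewrite /beyond (inj_eq emR_inj) !emR_lo !emR_hi !leq_add2l. Qed.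

Lemma beyond_emR_emL a b : nontrivial b -> beyond (emR a) (emL b) = false.
Proof.
move/emL_lo_lt => lb; rewrite /beyond emR_lo; apply/and3P => -[_ lab _].
by have := leq_trans (leq_addr _ _) lab; rewrite leqNgt lb.
Qed.

Lemma beyond_cut_emL b : nontrivial b -> beyond cut (emL b) = false.
Proof.
move/emL_lo_lt => lb; rewrite /beyond; have [-> _] := cut_lo_hi.
by rewrite leqNgt lb /= andbF.
Qed.

Lemma beyond_cut_emR b : nontrivial b -> beyond cut (emR b).
Proof.
rewrite emR_nontrivial => /andP[_ bc]; rewrite /beyond bc emR_lo emR_hi.
have [-> ->] := cut_lo_hi; rewrite leq_addr /=.
by have := hi_le b; move: (hi b); clear; lia.
Qed.

Lemma beyond_emL_cut a : nontrivial a -> beyond (emL a) cut = to_root a.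
Proof.
move=> aN; have := aN; rewrite emL_nontrivial => /andP[_ ac].
have := emL_lo_lt aN; rewrite /beyond eq_sym ac emL_lo emL_hi.
have [-> ->] := cut_lo_hi => /ltnW-> /=; case: ifP => _; first exact: leqnn.
by have := hi_le a; move: q0 (hi a); clear; lia.
Qed.

Lemma beyond_emR_cut a : nontrivial a -> beyond (emR a) cut = false.
Proof.
move=> aN; apply/negP => /and3P[_]; rewrite emR_lo emR_hi.
have [-> ->] := cut_lo_hi; have [|ar] := boolP (to_root a).
  move=> ar; have [-> _] := to_rootE ar; have := nontrivial_root aN ar.
  by move: (a.1 : nat) (hi a); clear; lia.
by have [_ _ ha] := mirror_nonroot ar; move: ha; move: (hi a) (lo a); clear; lia.
Qed.

Lemma beyond_emL_emR a b : nontrivial a -> nontrivial b ->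
  beyond (emL a) (emR b) = to_root a.
Proof.
move=> aN bN; have [ar|ar] := boolP (to_root a).
  by apply: beyond_trans (beyond_cut_emR bN); rewrite beyond_emL_cut.
apply/negP => /and3P[_ _]; rewrite emR_hi emL_hi (negPf ar).
have [_ _ ha] := mirror_nonroot ar; have := lo_lt_hi b; move: ha.
by move: (hi a) (lo b) (hi b); clear; lia.
Qed.

Lemma region_edge_Some N (d : {set arrow N}) r a :
  region_edge d r (Some a) =
  beyondr r a && [forall c in d, ~~ (beyondr r c && beyond c a)].
Proof. by []. Qed.

Section GluedDissection.
Variables (dl : {set arrow p.+1}) (dr : {set arrow q.+1}).
Hypotheses (dlD : dissection dl) (drD : dissection dr).
Local Notation d := (glue dl dr).

Let dlN a : a \in dl -> nontrivial a.
Proof. by case: (elimT (dissectionP dl) dlD) => dN _ /dN. Qed.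

Let drN a : a \in dr -> nontrivial a.
Proof. by case: (elimT (dissectionP dr) drD) => dN _ /dN. Qed.

Lemma regions_glue : regions d = (regL @: regions dl) :|: (regR @: regions dr).
Proof.
apply/setP => r; rewrite mem_regions; apply/idP/setUP.
  case: r => [c /mem_glue[->|[a ad ->]|[a ad ->]]|_].
  - by right; apply/imsetP; exists None; rewrite // mem_regions.
  - by left; apply/imsetP; exists (Some a); rewrite // mem_regions.
  - by right; apply/imsetP; exists (Some a); rewrite // mem_regions.
  - by left; apply/imsetP; exists None; rewrite // mem_regions.
case=> /imsetP[[a|]]; rewrite mem_regions => ad -> //=; apply/mem_glue.
- by constructor 2; exists a.
- by constructor 3; exists a.
- by constructor 1.
Qed.

Lemma start_regL_lt r : r \in regions dl -> start (regL r) < p.*2.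
Proof.
by rewrite mem_regions; case: r => [a /dlN/emL_lo_lt //|_] /=; rewrite double_gt0.
Qed.

Lemma start_regR_ge r : p.*2 <= start (regR r).
Proof. by rewrite start_regR leq_addr. Qed.

Lemma regR_inj : {in regions dr &, injective regR}.
Proof.
move=> r r'; rewrite !mem_regions.
case: r r' => [a|] [b|] //=.
- by move=> _ _ /Some_inj/emR_inj->.
- by move=> /drN + _ /Some_inj ac; rewrite emR_nontrivial ac eqxx andbF.
- by move=> _ /drN + /Some_inj ac; rewrite emR_nontrivial -ac eqxx andbF.
Qed.

Lemma beyondr_regL_emL r a : beyondr (regL r) (emL a) = beyondr r a.
Proof. by case: r => //= b; rewrite beyond_emL. Qed.

Lemma beyondr_regR_emR r a : a \in dr -> beyondr (regR r) (emR a) = beyondr r a.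
Proof. by case: r => [b|] ad /=; rewrite ?beyond_emR ?beyond_cut_emR ?drN. Qed.

Lemma beyondr_regL_cut r : r \in regions dl -> beyondr (regL r) cut = spine r.
Proof.
by rewrite mem_regions; case: r => //= a ad; rewrite beyond_emL_cut // dlN.
Qed.

Lemma beyondr_regL_emR r a : r \in regions dl -> a \in dr ->
  beyondr (regL r) (emR a) = spine r.
Proof.
rewrite mem_regions; case: r => //= b bd ad.
by rewrite beyond_emL_emR ?dlN ?drN.
Qed.

Lemma beyondr_regR_cut r : r \in regions dr -> beyondr (regR r) cut = false.
Proof.
rewrite mem_regions; case: r => [a ad|_] /=; first by rewrite beyond_emR_cut ?drN.
by rewrite /beyond eqxx.
Qed.

Lemma beyondr_regR_emL r a : a \in dl -> beyondr (regR r) (emL a) = false.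
Proof.
by case: r => [b|] ad /=; rewrite ?beyond_emR_emL ?beyond_cut_emL ?dlN.
Qed.

Lemma rib_regL r r' : r \in regions dl -> r' \in regions dl ->
  rib d (regL r) (regL r') = rib dl r r'.
Proof.
move=> rd; rewrite /rib spine_regL mem_regions; case: r' => [a ad|_] //.
rewrite /region_edge /= beyondr_regL_emL forall_glue.
rewrite beyond_cut_emL ?dlN // andbF /=; congr (_ && _ && _).
rewrite [X in _ && X](_ : _ = true) ?andbT; last first.
  by apply/forallP => c; rewrite beyond_emR_emL ?dlN // andbF implybT.
by apply: eq_forallb => c; rewrite beyondr_regL_emL beyond_emL.
Qed.

Lemma rib_regR r r' : r \in regions dr -> r' \in regions dr ->
  rib d (regR r) (regR r') = rib dr r r'.
Proof.
move=> rd; rewrite /rib spine_regR mem_regions; case: r' => [a ad|_]; last first.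
  by rewrite /= !andbF.
rewrite -[regR (Some a)]/(Some (emR a)) region_edge_Some beyondr_regR_emR //.
rewrite forall_glue beyondr_regR_cut //.
cbv beta; rewrite andFb andTb; congr (_ && _ && _).
rewrite [X in X && _](_ : _ = true) ?andTb; last first.
  by apply/forallP => c; apply/implyP => cd; rewrite beyondr_regR_emL.
apply: eq_forallb => c; case cd: (c \in dr) => //.
by rewrite beyondr_regR_emR // beyond_emR.
Qed.

(** The only edge between the two halves is [cut], which belongs to the
    spine. *)
Lemma rib_regLR r r' : r \in regions dl -> r' \in regions dr ->
  rib d (regL r) (regR r') = false.
Proof.
move=> rd; rewrite /rib spine_regR mem_regions; case: r' => [a ad|_]; last first.
  by rewrite /= andbF.
rewrite -[regR (Some a)]/(Some (emR a)) region_edge_Some beyondr_regL_emR //.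
rewrite forall_glue beyondr_regL_cut //.
by case: (spine r); rewrite //= beyond_cut_emR ?drN.
Qed.

Lemma rib_regRL r r' : r' \in regions dl -> rib d (regR r) (regL r') = false.
Proof.
rewrite /rib mem_regions; case: r' => [a ad|_] //.
by rewrite -[regL (Some a)]/(Some (emL a)) region_edge_Some beyondr_regR_emL.
Qed.

Lemma covers_emL a k : covers (emL a) (sideL k) = covers a k.
Proof.
rewrite /covers emL_lo emL_hi /spos val_sideL.
have [la ha lpa ->] := emL_bounds a; have := ltn_ord k; move: la ha lpa.
move: (lo a) (hi a) (k : nat); clear -q0 => l h u; do 2!case: ifP; lia.
Qed.

Lemma spos_sideR k : spos (sideR k) = p.*2 + spos k.
Proof. by rewrite /spos val_sideR doubleD addnS. Qed.

Lemma covers_emR a k : covers (emR a) (sideR k) = covers a k.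
Proof. by rewrite /covers emR_lo emR_hi spos_sideR !ltn_add2l. Qed.

Lemma on_region_regL r k : r \in regions dl ->
  on_region d (regL r) (sideL k) = on_region dl r k.
Proof.
move=> rd; rewrite /on_region; congr (_ && _).
  case: r rd => //= a _; rewrite emL_lo emL_hi /spos val_sideL.
  have [la ha lpa ->] := emL_bounds a; have := ltn_ord k; move: la ha lpa.
  by move: (lo a) (hi a) (k : nat); clear -q0 => l h u; do 2!case: ifP; lia.
have out l : p.*2 <= l -> (l < spos (sideL k) < n.*2.+1) = false.
  rewrite /spos val_sideL; have := ltn_ord k.
  by move: (k : nat); clear => u; case: ifP; lia.
rewrite forall_glue; cbv beta; have [-> ->] := cut_lo_hi.
rewrite out // implybT andTb [X in _ && X](_ : _ = true) ?andbT; last first.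
  apply/forallP => b; apply/implyP => _; apply/implyP => _; rewrite emR_lo.
  apply: contraFN (out (p.*2 + lo b) (leq_addr _ _)) => /andP[-> h] /=.
  by have := hi_le (emR b); exact: leq_trans.
apply: eq_forallb => b; rewrite beyondr_regL_emL; congr (_ ==> (_ ==> ~~ _)).
exact: covers_emL.
Qed.

Lemma on_region_regL_img r k : r \in regions dl -> on_region d (regL r) k ->
  exists i, k = sideL i.
Proof.
move=> rd /andP[rk /forallP H].
have kp : (k < p) || (k == n :> nat).
  apply: contraT => /norP[]; rewrite -leqNgt => pk kn.
  have kn' := ltn_ord k; have [rS|rS] := boolP (spine r).
    have := implyP (implyP (H cut) (cut_glue _ _)); rewrite beyondr_regL_cut //.
    move=> /(_ rS); have [-> ->] := cut_lo_hi; rewrite /spos.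
    by move: pk kn kn'; move: (k : nat); clear; lia.
  case: r rS rd rk {H} => //= a ar ad; rewrite emL_lo emL_hi (negPf ar).
  have [_ _ ha] := mirror_nonroot ar; rewrite /spos; move: pk ha.
  by move: (k : nat) (lo a) (hi a); clear; lia.
exists (inord (if k == n :> nat then p else k)); apply: val_inj => /=.
rewrite val_sideL inordK; last first.
  by move: kp; move: (k : nat); clear => u; case: ifP; lia.
by move: kp; move: (k : nat); clear => u; do 2!case: ifP; lia.
Qed.

Lemma sideL_mono : {homo sideL : i j / i < j}.
Proof.
move=> i j ij; rewrite !val_sideL; have := ltn_ord j; have := ltn_ord i.
by move: q0 ij; move: (i : nat) (j : nat); clear => u v; do 2!case: ifP; lia.
Qed.

Lemma sideR_mono : {homo sideR : i j / i < j}.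
Proof. by move=> i j ij; rewrite !val_sideR ltn_add2l. Qed.

Lemma trace_regL r : r \in regions dl ->
  trace d (regL r) = map sideL (trace dl r).
Proof.
move=> rd; apply: filter_embed => [|i|k]; first exact: sideL_mono.
  exact: on_region_regL.
exact: on_region_regL_img.
Qed.

Lemma on_region_regR r k : r \in regions dr ->
  on_region d (regR r) (sideR k) = on_region dr r k.
Proof.
move=> rd; rewrite /on_region; congr (_ && _).
  case: r rd => [a|] _ /=; first by rewrite emR_lo emR_hi spos_sideR !leq_add2l.
  have [-> ->] := cut_lo_hi; rewrite spos_sideR leq_addr /spos.
  by have := ltn_ord k; move: (k : nat); clear; lia.
rewrite forall_glue; cbv beta; rewrite beyondr_regR_cut // implyFb andTb.
rewrite [X in X && _](_ : _ = true) ?andTb; last first.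
  by apply/forallP => b; apply/implyP => bd; rewrite beyondr_regR_emL.
apply: eq_forallb => b; case bd: (b \in dr) => //.
rewrite beyondr_regR_emR //; congr (_ ==> (_ ==> ~~ _)); exact: covers_emR.
Qed.

Lemma on_region_regR_img r k : on_region d (regR r) k -> exists i, k = sideR i.
Proof.
move=> /andP[rk _].
have pk : p <= k.
  have: p.*2 <= spos k.
    apply: leq_trans (start_regR_ge r) _.
    by case: r rk => [a|] /= /andP[].
  by rewrite /spos; move: (k : nat); clear; lia.
exists (inord (k - p)); apply: val_inj => /=; rewrite val_sideR inordK ?subnKC //.
by have := ltn_ord k; move: (k : nat) pk; clear; lia.
Qed.

Lemma trace_regR r : r \in regions dr ->
  trace d (regR r) = map sideR (trace dr r).
Proof.
move=> rd; apply: filter_embed => [|i|k]; first exact: sideR_mono.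
  exact: on_region_regR.
exact: on_region_regR_img.
Qed.

Lemma wt_regL r : r \in regions dl -> wt d (regL r) = wt dl r.
Proof. by move=> rd; rewrite /wt trace_regL // size_map. Qed.

Lemma wt_regR r : r \in regions dr -> wt d (regR r) = wt dr r.
Proof. by move=> rd; rewrite /wt trace_regR // size_map. Qed.

Lemma reversed_regL r : reversed (regL r) = reversed r.
Proof.
case: r => //= a; rewrite /backwards val_emL1 val_sideL.
have := ltn_ord a.1; move: q0 (a.1 : nat) (a.2 : nat); clear => q0 u v.
by case: ifP; lia.
Qed.

Lemma reversed_regR r : reversed (regR r) = reversed r.
Proof.
case: r => [a|] /=; first by rewrite /backwards val_emR1 val_sideR ltn_add2l.
exact: (@reversed_spine n (Some cut) cut_root).
Qed.

Lemma sgn_glue : sgn d = (sgn dl * sgn dr)%R.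
Proof.
have cutN : cut \notin emL @: dl :|: emR @: dr.
  rewrite inE; apply/norP; split; apply/imsetP => -[a ad ca].
    by have := dlN ad; rewrite emL_nontrivial -ca eqxx andbF.
  by have := drN ad; rewrite emR_nontrivial -ca eqxx andbF.
have disj : [disjoint emL @: dl & emR @: dr].
  apply/pred0P => c /=; apply/negP => /andP[/imsetP[a ad ->] /imsetP[b bd ab]].
  by have := emL_neq_emR b (dlN ad); rewrite ab eqxx.
have back_cut : backwards cut = false.
  exact: (@reversed_spine n (Some cut) cut_root).
rewrite {1}/sgn big_mkcondr /= big_setU1 //= back_cut mul1r.
rewrite (eq_bigl [in [predU emL @: dl & emR @: dr]]) => [|c]; last by rewrite !inE.
rewrite bigU //=.
rewrite !big_imset /=; last 2 first.
- by move=> a b _ _; apply: emR_inj.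
- by move=> a b _ _; apply: emL_inj.
rewrite /sgn !big_mkcondr; congr (_ * _)%R; apply: eq_bigr => a ad.
  rewrite -[backwards _]/(reversed (regL (Some a))) reversed_regL.
  by rewrite -[Some (emL a)]/(regL (Some a)) wt_regL ?mem_regions.
rewrite -[backwards _]/(reversed (regR (Some a))) reversed_regR.
by rewrite -[Some (emR a)]/(regR (Some a)) wt_regR ?mem_regions.
Qed.

Lemma root_arrows_cut :
  [set b in root_arrows d | lo cut < lo b] = emR @: root_arrows dr.
Proof.
have [-> _] := cut_lo_hi; apply/setP => c.
rewrite in_set [c \in root_arrows _]in_set.
apply/andP/imsetP => [[/andP[/mem_glue[->|[a ad ->]|[a ad ->]] cr]]|[a]].
- by have [-> _] := cut_lo_hi; rewrite ltnn.
- by move/ltnW; rewrite leqNgt emL_lo_lt ?dlN.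
- by move=> _; exists a; rewrite // inE ad -emR_root.
rewrite inE => /andP[ad ar] ->; rewrite emR_root ar; split.
  by rewrite andbT; apply/mem_glue; constructor 3; exists a.
rewrite emR_lo -[X in X < _]addn0 ltn_add2l.
by have := root_arrow_lo drD (a := a); rewrite inE ad ar => /(_ isT)[].
Qed.

End GluedDissection.

End Glue.

(** * The two sides of the congruence *)

(** An arrow off the spine is either forwards or backwards, so that the product
    of [sgn d], of [sgn_fwd d] and of the signs of the weights on the spine is
    the sign of the total weight [n]; the spine has one region more than
    arrows. *)
Lemma sgn_turn n (d : {set arrow n.+1}) : (0 < n)%N -> dissection d ->
  sgn_fwd d * \prod_(r in regions d | spine r) (-1) ^+ (wt d r).+1
  = (-1) ^+ n * (-1) ^+ #|root_arrows d|.+1 * sgn d.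
Proof.
move=> n0 dD; have [dN _] := elimT (dissectionP d) dD.
have regsE (F : option (arrow n.+1) -> rat) :
    \prod_(r in regions d) F r = F None * \prod_(a in d) F (Some a).
  rewrite /regions big_setU1 /=; last by apply/imsetP => -[].
  by rewrite big_imset //= => a b _ _ [].
have total : \prod_(r in regions d) (-1) ^+ wt d r = (-1) ^+ n :> rat.
  by rewrite -expr_sum sum_wt.
have split_sign : \prod_(r in regions d | spine r) (-1) ^+ (wt d r).+1 =
   (-1) ^+ #|root_arrows d|.+1 * ((-1) ^+ wt d None *
     \prod_(a in d | to_root a) (-1) ^+ wt d (Some a)) :> rat.
  rewrite big_mkcondr regsE /= -big_mkcondr /=.
  under eq_bigr do rewrite exprS.
  rewrite big_split /= prodr_const !exprS.
  have -> : #|[pred a in d | to_root a]| = #|root_arrows d|.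
    by apply: eq_card => a; rewrite !inE.
  ring.
have fwd_bwd : \prod_(a in d) (-1) ^+ wt d (Some a) =
   \prod_(a in d | to_root a) (-1) ^+ wt d (Some a) * sgn_fwd d * sgn d :> rat.
  rewrite (bigID (@to_root n)) /= -mulrA; congr (_ * _).
  rewrite (bigID (@forwards n.+1)) /=; congr (_ * _).
    by apply: eq_bigl => a; rewrite andbAC andbA.
  apply: eq_bigl => a; case ad: (a \in d) => //=.
  have [+ _ _] := nontrivial_neq (dN a ad).
  have := ltn_ord a.1; rewrite /to_root /forwards /backwards.
  by move: (a.1 : nat) (a.2 : nat); clear; lia.
have sq : sgn d * sgn d = 1.
  rewrite /sgn -big_split /= big1 // => a _.
  by rewrite -exprD addnn -mul2n exprM sqrrN expr1n.
rewrite split_sign -total regsE fwd_bwd.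
set A := (-1) ^+ wt d None; set B := \prod_(a in d | _) _.
rewrite -[sgn_fwd d in LHS]mulr1 -sq; ring.
Qed.

Section Turned.
Variables (R : choiceType) (P0 : polygon R).

Lemma wt_le n (d : {set arrow n.+1}) r : (wt d r <= n)%N.
Proof.
rewrite /wt /trace; have := count_size (on_region d r) (enum 'I_n.+1).
by rewrite -size_filter size_enum_ord; case: size.
Qed.

Lemma cong_turned N n (x : 'I_n.+1 -> R) (d : {set arrow n.+1})
    (E : rel (option (arrow n.+1))) m : (0 < n <= N)%N -> dissection d ->
  cong N (Lambda (Forest (regions d) E (turned P0 x m d)))
    ((\prod_(r in regions d | spine r && (m <= start r)%N)
        (-1) ^+ (wt d r).+1) *: Lambda (Forest (regions d) E (lab P0 x d))).
Proof.
move=> /andP[n0 nN] dD; rewrite big_mkcondr; apply: cong_Lambda => r rd.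
rewrite /turned; case: ifP => _; last by rewrite scale1r; apply: cong_refl.
have wE : weight (lab P0 x d r) = wt d r by rewrite weight_lab.
rewrite -wE; apply: cong_tau; rewrite wE.
exact: leq_trans (wt_le _ _) nN.
Qed.

End Turned.

Section GlueSum.
Variables (R : choiceType) (P0 : polygon R) (p q : nat).
Hypotheses (p0 : (0 < p)%N) (q0 : (0 < q)%N).
Variable x : 'I_(p + q).+1 -> R.

Section GlueForest.
Variables (dl : {set arrow p.+1}) (dr : {set arrow q.+1}).
Hypotheses (dlD : dissection dl) (drD : dissection dr).
Local Notation d := (glue dl dr).

Lemma lab_regL r : r \in regions dl ->
  lab P0 x d (regL q r) = lab P0 (x \o @sideL p q) dl r.
Proof.
move=> rd; rewrite /lab reversed_regL // trace_regL //.
by case: ifP => _; rewrite -?map_rev -map_comp.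
Qed.

Lemma lab_regR r : r \in regions dr ->
  lab P0 x d (regR p r) = lab P0 (x \o @sideR p q) dr r.
Proof.
move=> rd; rewrite /lab reversed_regR // trace_regR //.
by case: ifP => _; rewrite -?map_rev -map_comp.
Qed.

(** Folding at the starting point of [cut] removes the edge [cut], and leaves the
    first half of the spine increasing and the second one decreasing. *)
Lemma Lambda_glue :
  Lambda (Forest (regions d) (folded d p.*2) (turned P0 x p.*2 d))
  = shuffle
     (Lambda (Forest (regions dl) (folded dl p.*2.+1)
               (lab P0 (x \o @sideL p q) dl)))
     (Lambda (Forest (regions dr) (folded dr 0)
               (turned P0 (x \o @sideR p q) 0 dr))).
Proof.
pose low := [set r : option (arrow (p + q).+1) | (start r < p.*2)%N].
have lowL r : r \in regions dl -> regL q r \in low.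
  by move=> rd; rewrite inE (start_regL_lt p0 q0 dlD).
have lowR r : (regR p r \in low) = false.
  by rewrite inE ltnNge start_regR_ge.
have dE := regions_glue dl dr.
rewrite (@Lambda_disjoint _ _ _ low); last first.
  move=> r r'; rewrite dE => /setUP[] /imsetP[u ud ->] /setUP[] /imsetP[v vd ->].
  - by rewrite !lowL.
  - rewrite /folded rib_regLR // /bent lowL // lowR.
    have := start_regL_lt p0 q0 dlD ud; have := start_regR_ge p v.
    by move: (start _) (start _) => s t h1 h2 /and3P[_ _]; lia.
  - rewrite /folded rib_regRL // /bent lowL // lowR.
    have := start_regL_lt p0 q0 dlD vd; have := start_regR_ge p u.
    by move: (start _) (start _) => s t h1 h2 /and3P[_ _]; lia.
  - by rewrite !lowR.
have -> : regions d :&: low = @regL p q @: regions dl.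
  apply/setP => r; rewrite in_setI dE in_setU; apply/andP/idP => [[/orP[]]|] //.
    by move=> /imsetP[u _ ->]; rewrite lowR.
  by move=> /[dup] rd ->; split=> //; case/imsetP: rd => u ud ->; apply: lowL.
have -> : regions d :\: low = @regR p q @: regions dr.
  apply/setP => r; rewrite in_setD dE in_setU; apply/andP/idP => [[rl /orP[]]|] //.
    by move=> /imsetP[u ud rE]; rewrite rE lowL in rl.
  move=> /[dup] rd ->; rewrite orbT; split=> //.
  by case/imsetP: rd => u ud ->; rewrite lowR.
congr shuffle; apply: Lambda_iso.
- by move=> r r' _ _; apply: regL_inj.
- by [].
- move=> r r' rd r'd; rewrite /folded rib_regL //; congr (_ || _).
  rewrite /bent !spine_regL // !start_regL //; congr [&& _, _ & _].
  have := start_regL_lt p0 q0 dlD rd; have := start_regL_lt p0 q0 dlD r'd.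
  by rewrite !start_regL //; move: (start r) (start r'); clear; lia.
- move=> r rd; have := lowL r rd; rewrite inE /turned => sl.
  by rewrite leqNgt sl andbF lab_regL.
- exact: regR_inj.
- by [].
- move=> r r' rd r'd; rewrite /folded rib_regR //; congr (_ || _).
  rewrite /bent !spine_regR // !start_regR //; congr [&& _, _ & _].
  by move: (start r) (start r'); clear; lia.
- move=> r rd; rewrite /turned spine_regR // start_regR_ge !andbT.
  by rewrite lab_regR.
Qed.

End GlueForest.

End GlueSum.

Lemma eq_glue_sum (V : nmodType) p q (p0 : (0 < p)%N) (q0 : (0 < q)%N)
    (F : {set arrow (p + q).+1} -> V) :
  \sum_(dl : {set arrow p.+1} | dissection dl)
    \sum_(dr : {set arrow q.+1} | dissection dr) F (glue dl dr)
  = \sum_(d | dissection d && (cut p q \in d)) F d.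
Proof.
rewrite pair_big /=.
rewrite [RHS](reindex_onto (fun dd => glue dd.1 dd.2)
  (fun d : {set arrow (p + q).+1} => (@partL p q d, @partR p q d))) /=; last first.
  by move=> d /andP[dD cd]; apply: glue_parts.
apply: eq_bigl => -[dl dr] /=; rewrite cut_glue andbT.
apply/andP/andP => [[dlD drD]|[dD /eqP[el er]]].
  by rewrite glue_dissection // partL_glue // partR_glue.
split; [rewrite -el|rewrite -er].
  exact: partL_dissection.
exact: partR_dissection.
Qed.

Section CutTerm.
Variables (R : choiceType) (P0 : polygon R) (N p q : nat).
Hypotheses (p0 : (0 < p)%N) (q0 : (0 < q)%N) (nN : (p + q <= N)%N).
Variable x : 'I_(p + q).+1 -> R.

Let n0 : (0 < p + q)%N. Proof. by rewrite addn_gt0 p0. Qed.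

Lemma sign_cut (dl : {set arrow p.+1}) (dr : {set arrow q.+1}) :
  dissection dl -> dissection dr ->
  (-1) ^+ q.-1 * (sgn dl * sgn_fwd dr) *
    \prod_(r in regions (glue dl dr) | spine r && (p.*2 <= start r)%N)
       (-1) ^+ (wt (glue dl dr) r).+1 =
  (-1) ^+ #|[set b in root_arrows (glue dl dr) | (p.*2 < lo b)%N]|
    * sgn (glue dl dr) :> rat.
Proof.
move=> dlD drD; have rc := root_arrows_cut q0 dlD drD.
rewrite (cut_lo_hi p q).1 in rc; rewrite rc card_imset; last exact: emR_inj.
have -> : \prod_(r in regions (glue dl dr) | spine r && (p.*2 <= start r)%N)
       (-1) ^+ (wt (glue dl dr) r).+1 =
   \prod_(r in regions dr | spine r) (-1) ^+ (wt dr r).+1 :> rat.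
  rewrite regions_glue.
  rewrite (eq_bigl (fun r => (r \in @regR p q @: regions dr) && spine r)).
    rewrite big_imset_cond; last exact: regR_inj.
    apply: eq_big => [r|r /andP[rd _]]; first by rewrite spine_regR.
    by rewrite wt_regR.
  move=> r; rewrite in_setU; apply/andP/andP => -[].
    case/orP=> /imsetP[u ud ->] /andP[uS us]; last by rewrite imset_f.
    by have := start_regL_lt p0 q0 dlD ud; rewrite ltnNge us.
  move=> /[dup] rd -> rS; rewrite orbT rS.
  by case/imsetP: rd => u _ ->; rewrite start_regR_ge.
set turn := \prod_(r in regions dr | _) _.
have -> : (-1) ^+ q.-1 * (sgn dl * sgn_fwd dr) * turn =
   (-1) ^+ q.-1 * sgn dl * (sgn_fwd dr * turn) by rewrite !mulrA.
have qE : (-1) ^+ q = - (-1) ^+ q.-1 :> rat.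
  by rewrite -[in LHS](prednK q0) exprS mulN1r.
rewrite sgn_turn // sgn_glue // qE exprS.
have : (-1) ^+ q.-1 * (-1) ^+ q.-1 = 1 :> rat.
  by rewrite -exprD addnn -mul2n exprM sqrrN expr1n.
move: ((-1) ^+ q.-1) ((-1) ^+ #|_|) (sgn dl) (sgn dr) => e k sl sr ee.
by transitivity (e * e * (k * (sl * sr))); [ring|rewrite ee mul1r].
Qed.

(** The signs coming from the reflected labels on the second half of the spine
    turn [sgn_fwd] of the cut-off part back into [sgn], up to the parity of the
    number of arrows to the root side beyond [cut]. *)
Lemma cong_shuffle_cut :
  cong N ((-1) ^+ q.-1 *: shuffle (Lambda_sides P0 (x \o @sideL p q))
            (Lambda_sides P0 ((x \o @sideR p q) \o @mirror_side q)))
    (\sum_(d | dissection d && (cut p q \in d))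
       ((-1) ^+ #|[set b in root_arrows d | (lo (cut p q) < lo b)%N]| * sgn d)
         *:
         Lambda (Forest (regions d) (folded d (lo (cut p q))) (lab P0 x d))).
Proof.
rewrite Lambda_sides_mirror // /Lambda_sides shuffle_suml scaler_sumr.
rewrite -eq_glue_sum //.
apply: cong_sum => dl dlD; rewrite shuffleZl shuffle_sumr scalerA scaler_sumr.
apply: cong_sum => dr drD; rewrite shuffleZr -Lambda_glue // scalerA.
have [-> _] := cut_lo_hi p q; rewrite -mulrA.
have dD : dissection (glue dl dr) by apply: glue_dissection.
have := @cong_turned R P0 N _ x (glue dl dr) (folded (glue dl dr) p.*2) p.*2.
rewrite n0 nN => /(_ isT dD)/(congZ ((-1) ^+ q.-1 * (sgn dl * sgn_fwd dr))).
by rewrite scalerA (sign_cut dlD drD).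
Qed.

End CutTerm.

Lemma map_sideL p q : map (@sideL p q) (enum 'I_p.+1) =
  take p (enum 'I_(p + q).+1) ++ drop (p + q) (enum 'I_(p + q).+1).
Proof.
apply: (inj_map val_inj); rewrite map_cat map_take map_drop val_enum_ord.
rewrite take_iota drop_iota add0n subSnn -map_comp.
rewrite (minn_idPl (leqW (leq_addr q p))).
rewrite (eq_map (g := (fun k => if k == p then p + q else k)%N \o val)); last first.
  by move=> k; rewrite /= val_sideL.
rewrite map_comp val_enum_ord -[p.+1]addn1 iotaD map_cat /= eqxx; congr (_ ++ _).
rewrite -[RHS]map_id; apply/eq_in_map => k; rewrite mem_iota add0n => /andP[_ kp].
by rewrite ltn_eqF.
Qed.

Lemma map_sideR p q : map (@sideR p q) (enum 'I_q.+1) =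
  drop p (enum 'I_(p + q).+1).
Proof.
apply: (inj_map val_inj); rewrite map_drop val_enum_ord drop_iota -map_comp.
rewrite (eq_map (g := addn p \o val)); last by move=> k; rewrite /= val_sideR.
rewrite map_comp val_enum_ord -iotaDl addn0 add0n; congr iota.
by rewrite -addnS addKn.
Qed.

Lemma sides_prt (R : Type) p q (x : 'I_(p + q).+1 -> R) (P : polygon R) :
  (0 < p)%N -> (0 < q)%N -> sides P = map x (enum 'I_(p + q).+1) ->
  sides (prt P p (p + q)) = map (x \o @sideL p q) (enum 'I_p.+1).
Proof.
move=> p0 q0 Px; rewrite /prt -[X in (X < _)%N]addn0 ltn_add2l q0.
have -> : take p P ++ drop (p + q) P = map (x \o @sideL p q) (enum 'I_p.+1).
  by rewrite Px map_comp map_sideL map_cat map_take map_drop.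
by rewrite mkpolyE // size_map size_enum_ord.
Qed.

Lemma sides_pco (R : Type) p q (x : 'I_(p + q).+1 -> R) (P : polygon R) :
  (0 < p)%N -> (0 < q)%N -> sides P = map x (enum 'I_(p + q).+1) ->
  sides (pco P p (p + q)) = map (x \o @sideR p q) (enum 'I_q.+1).
Proof.
move=> p0 q0 Px; rewrite /pco -[X in (X < _)%N]addn0 ltn_add2l q0.
have -> : drop p (take (p + q).+1 P) = map (x \o @sideR p q) (enum 'I_q.+1).
  rewrite map_comp map_sideR map_drop -Px take_oversize //.
  by rewrite Px size_map size_enum_ord.
by rewrite mkpolyE // size_map size_enum_ord.
Qed.

Definition root_arrow n p : arrow n.+1 := (inord p, ord_max).

Lemma cong_root_arrow (R : choiceType) (P0 P : polygon R) n p
    (x : 'I_n.+1 -> R) : (0 < p < n)%N -> sides P = map x (enum 'I_n.+1) ->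
  cong n ((-1) ^+ (n - p.+1) *:
      shuffle (Lambda_phi2 (prt P p n)) (Lambda_phi2 (tau (pco P p n))))
    (\sum_(d | dissection d && (root_arrow n p \in d))
       ((-1) ^+ #|[set b in root_arrows d | (lo (root_arrow n p) < lo b)%N]|
          * sgn d) *:
         Lambda (Forest (regions d) (folded d (lo (root_arrow n p))) (lab P0 x d))).
Proof.
move=> /andP[p0 pn]; have nE := subnKC (ltnW pn).
have q0 : (0 < n - p)%N by rewrite subn_gt0.
move: (n - p)%N q0 nE => q q0 nE; subst n => Px {pn}.
rewrite subnS addKn (Lambda_phi2E P0 (sides_prt p0 q0 Px)).
rewrite (Lambda_phi2E P0 (sides_tau_map (sides_pco p0 q0 Px))).
exact: cong_shuffle_cut.
Qed.

(** Nontriviality excludes the vertices 0 and [n]. *)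
Lemma sum_root_arrows (V : nmodType) n (d : {set arrow n.+1})
    (F : arrow n.+1 -> V) :
  dissection d ->
  \sum_(a in root_arrows d) F a =
  \sum_(1 <= p < n | root_arrow n p \in d) F (root_arrow n p).
Proof.
move=> dD; have [dN _] := elimT (dissectionP d) dD.
rewrite (reindex_onto (fun p : 'I_n.+1 => (p, ord_max)) (fun a => a.1)) /=.
  rewrite [RHS](big_nat_widenl _ 0) // [RHS](big_nat_widen _ _ n.+1) //.
  rewrite big_mkord; apply: eq_big => [p|p _]; last first.
    by rewrite /root_arrow inord_val.
  rewrite /root_arrow inord_val inE eqxx andbT [to_root _]eqxx andbT -andbA.
  apply/esym/andb_idr => /dN pN.
  by have := nontrivial_root pN (eqxx _); rewrite /= => /andP[-> ->].
by move=> [i j]; rewrite inE => /andP[_ /eqP jn]; congr (_, _); apply: val_inj.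
Qed.

Theorem theorem63 (R : choiceType) (n : nat) (P : polygon R)
    (hP : weight P = n) :
  q_ n (Lambda_phi2 P + (-1) ^+ n *: Lambda_phi2 (tau P)) =
  q_ n (\sum_(2 <= i < n.+1)
          (-1) ^+ (n - i) *:
            shuffle (Lambda_phi2 (prt P i.-1 n))
                    (Lambda_phi2 (tau (pco P i.-1 n)))).
Proof.
apply/qP; rewrite -/(cong n _ _).
have n0 : (0 < n)%N by rewrite -hP /weight; have := sides_gt1 P; lia.
have sP : size P = n.+1 by rewrite -hP /weight prednK // ltnW // sides_gt1.
have [x Px] : exists x : 'I_n.+1 -> R, sides P = map x (enum 'I_n.+1).
  have P_gt0 : (0 < size P)%N by rewrite sP.
  pose x0 := tnth (in_tuple P) (Ordinal P_gt0).
  exists (nth x0 P); transitivity (map (nth x0 P) (map val (enum 'I_n.+1))).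
    by rewrite val_enum_ord -sP map_nth_iota0 ?take_size.
  by rewrite -map_comp.
rewrite (Lambda_phi2E P Px) (Lambda_phi2E P (sides_tau_map Px)).
rewrite Lambda_sides_mirror //.
rewrite big_add1 /=.
pose L d m := Lambda (Forest (regions d) (folded d m) (lab P x d)).
(* Undo the reflection of the labels on the spine of each mirror image. *)
apply: (@cong_trans _ _ (\sum_(d | dissection d)
   sgn d *: (L d n.*2.+1 - (-1) ^+ #|root_arrows d| *: L d 0))).
  rewrite /Lambda_sides scaler_sumr -big_split /=; apply: cong_sum => d dD.
  rewrite scalerBr; apply: congD; first exact: cong_refl.
  have nn : (0 < n <= n)%N by rewrite n0 leqnn.
  have sign_d : (-1) ^+ n * sgn_fwd d *
      \prod_(r in regions d | spine r && (0 <= start r)%N) (-1) ^+ (wt d r).+1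
      = - (sgn d * (-1) ^+ #|root_arrows d|) :> rat.
    under eq_bigl do rewrite andbT.
    rewrite -mulrA sgn_turn // !mulrA -exprD addnn -mul2n exprM sqrrN !expr1n.
    by rewrite mul1r exprS mulN1r mulNr mulrC.
  have := congZ ((-1) ^+ n * sgn_fwd d) (cong_turned P x (folded d 0) 0 nn dD).
  by rewrite !scalerA sign_d -scaleNr.
apply: (@cong_trans _ _ (\sum_(1 <= p < n)
   \sum_(d | dissection d && (root_arrow n p \in d))
     ((-1) ^+ #|[set b in root_arrows d | (lo (root_arrow n p) < lo b)%N]|
        * sgn d) *: L d (lo (root_arrow n p)))); last first.
  rewrite !big_nat; apply: cong_sum => p /andP[p0 pn]; apply: cong_sym.
  by apply: cong_root_arrow; rewrite ?p0.
(* Each dissection now occurs once for every arrow to the root side in it. *)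
rewrite (exchange_big_dep (@dissection n.+1)) /=; last by move=> ? ? _ /andP[].
apply: cong_sum => d dD; rewrite -(Lambda_telescope dD) sum_root_arrows //.
under [X in cong _ _ X]eq_bigl do rewrite dD.
rewrite scaler_sumr.
under [X in cong _ _ X]eq_bigr do rewrite mulrC -scalerA.
exact: cong_refl.
Qed.
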